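(* For $i\in\{1,2\}$ let $G_i$ be a finite graph on $n_i$ vertices with no universal vertex, and let $k_i$ be a natural number with $k_i\le n_i-2$. If $\mathcal{B}_{\geq k_1}(G_1)\cong\mathcal{B}_{\geq k_2}(G_2)$, then $G_1\cong G_2$. (That is, a graph $G$ with no universal vertices is uniquely determined by $\mathcal{B}_{\geq k}(G)$ whenever $k\le |V(G)|-2$.)
   Context: All graphs are finite and simple. A vertex of $G$ is universal if it has degree $|V(G)|-1$. An independent set partition of $G$ is a partition of $V(G)$ into nonempty independent sets (parts). For such a partition $P$ and $v\in V(G)$, let $P-v$ be the partition of $V(G)\setminus\{v\}$ obtained by deleting $v$ from its part (discarding that part if it becomes empty). The Bell colouring graph $\mathcal{B}(G)$ has as vertices the independent set partitions of $G$, with $P\neq Q$ adjacent iff $P-v=Q-v$ for some $v\in V(G)$. For a natural number $k$, the upper-Bell $k$-colouring graph $\mathcal{B}_{\geq k}(G)$ is the induced subgraph of $\mathcal{B}(G)$ on the partitions with at least $k$ parts. *)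

(* Defs.v *)
From HB Require Import structures.
From mathcomp Require Import all_boot.

Set Implicit Arguments.
Unset Strict Implicit.
Unset Printing Implicit Defensive.

Record sgraph := SGraph {
  vertex :> finType;
  adj : rel vertex;
  adj_sym : symmetric adj;
  adj_irrefl : irreflexive adj
}.

Definition isomorphic (G H : sgraph) : Prop :=
  exists2 f : G -> H, bijective f & forall x y : G, adj (f x) (f y) = adj x y.

Definition degree (G : sgraph) (v : G) : nat := #|[set w : G | adj v w]|.

Definition universal (G : sgraph) (v : G) : bool := degree v == #|G|.-1.

Definition independent (G : sgraph) (A : {set G}) : bool :=
  [forall x in A, forall y in A, ~~ adj x y].

Section Induced.
Variables (G : sgraph) (A : {set G}).

Definition induced_adj : rel {x : G | x \in A} :=
  fun x y => adj (val x) (val y).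

Lemma induced_adj_sym : symmetric induced_adj.
Proof. by move=> x y; apply: adj_sym. Qed.

Lemma induced_adj_irrefl : irreflexive induced_adj.
Proof. by move=> x; apply: adj_irrefl. Qed.

Definition induced : sgraph := SGraph induced_adj_sym induced_adj_irrefl.
End Induced.

(* [partition P [set: G]] already requires the parts to be nonempty. *)
Definition indep_partition (G : sgraph) (P : {set {set G}}) : bool :=
  partition P [set: G] && [forall B in P, independent B].

Definition del_vertex (G : sgraph) (P : {set {set G}}) (v : G) : {set {set G}} :=
  [set B :\ v | B in P] :\ set0.

Section Bell.
Variable G : sgraph.

Definition bell_adj : rel {P : {set {set G}} | indep_partition P} :=
  fun P Q => (P != Q) &&
    [exists v : G, del_vertex (val P) v == del_vertex (val Q) v].

Lemma bell_adj_sym : symmetric bell_adj.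
Proof.
move=> P Q; rewrite /bell_adj eq_sym; congr (_ && _).
by apply: eq_existsb => v; rewrite eq_sym.
Qed.

Lemma bell_adj_irrefl : irreflexive bell_adj.
Proof. by move=> P; rewrite /bell_adj eqxx. Qed.

Definition bell_graph : sgraph := SGraph bell_adj_sym bell_adj_irrefl.
End Bell.

Definition upper_bell (k : nat) (G : sgraph) : sgraph :=
  induced [set P : bell_graph G | k <= #|val P|].

(* Main.v *)
Require Import Defs.
From mathcomp Require Import all_boot zify.

(* Let H be the complement of G, so that parts are cliques of H and H has no
   isolated vertex. The neighbours of the partition T into singletons are the
   partitions merging one edge of H, and they induce the line graph of H. Three
   pairwise adjacent neighbours have a common neighbour far from T (distinct from
   T and not adjacent to it) exactly when the three edges form a triangle, so the
   exceptional case of Whitney's theorem does not arise and H can be recovered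
   from T and the graph.
   An isomorphism may send T to another partition Q, but Q inherits the local
   properties [line_like] of T. These force the parts of Q to have at most 3
   elements, and every neighbour of Q to arise from moving a vertex into a
   singleton or out of its part; such moves inject into the edges of H. Hence
   the isomorphism does not decrease the number of edges; applied in both
   directions this gives equality, and then the neighbours of Q again form the
   line graph of H, where three edges through a common vertex have no far common
   neighbour. So an isomorphism maps triangles of H to triangles, and comparing
   the numbers of triangles shows that stars are mapped to stars too. *)

Set Implicit Arguments.
Unset Strict Implicit.
Unset Printing Implicit Defensive.

(** * Partitions as equivalence relations *)

Section SamePart.
Variables (G : sgraph) (k : nat).
Local Notation UB := (upper_bell k G).
Implicit Types (P R : UB) (x y v : G).

Definition same_part P x y : bool := y \in pblock (val (val P)) x.

Lemma parts_partition P : partition (val (val P)) [set: G].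
Proof. by case/andP: (valP (val P)). Qed.

Let mem_coverP P x : x \in cover (val (val P)).
Proof. by rewrite (cover_partition (parts_partition P)) inE. Qed.

Let trivP P : trivIset (val (val P)).
Proof. by case/and3P: (parts_partition P). Qed.

Lemma same_partE P x y :
  same_part P x y = (pblock (val (val P)) x == pblock (val (val P)) y).
Proof. by rewrite /same_part eq_pblock. Qed.

Lemma same_part_refl P x : same_part P x x.
Proof. by rewrite same_partE. Qed.

Lemma same_part_sym P x y : same_part P x y = same_part P y x.
Proof. by rewrite !same_partE eq_sym. Qed.

Lemma same_part_trans P y x z :
  same_part P x y -> same_part P y z -> same_part P x z.
Proof. by rewrite !same_partE => /eqP->. Qed.

Lemma same_part_nadj P x y : same_part P x y -> ~~ adj x y.
Proof.
move=> Pxy; have /andP[_ /forall_inP indP] := valP (val P).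
have /indP/forall_inP/(_ x) := pblock_mem (mem_coverP P x).
by rewrite mem_pblock => /(_ (mem_coverP P x))/forall_inP/(_ y Pxy).
Qed.

Let mem_part P B x : B \in val (val P) -> x \in B -> pblock (val (val P)) x = B.
Proof. exact/def_pblock. Qed.

Let part_neq0 P B : B \in val (val P) -> exists x, x \in B.
Proof.
move=> PB; apply/set0Pn; apply: contraTneq PB => ->.
by case/and3P: (parts_partition P).
Qed.

Lemma same_part_inj P R : same_part P =2 same_part R -> P = R.
Proof.
have sub P1 P2 : same_part P1 =2 same_part P2 -> val (val P1) \subset val (val P2).
  move=> eqP12; apply/subsetP=> B PB; have [x Bx] := part_neq0 PB.
  have <- : pblock (val (val P2)) x = B.
    by rewrite -(mem_part PB Bx); apply/setP => y; rewrite -/(same_part _ _ _) -eqP12.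
  exact/pblock_mem/mem_coverP.
move=> eqPR; do 2!apply: val_inj; apply/eqP; rewrite eqEsubset !sub //.
Qed.

Definition agree_off v P R :=
  forall x y, x != v -> y != v -> same_part P x y = same_part R x y.

Lemma agree_off_sym v P R : agree_off v P R -> agree_off v R P.
Proof. by move=> PR x y xv yv; rewrite PR. Qed.

Lemma agree_off_trans v P R S : agree_off v P R -> agree_off v R S -> agree_off v P S.
Proof. by move=> PR RS x y xv yv; rewrite PR // RS. Qed.

Lemma del_vertexP v P R :
  reflect (agree_off v P R) (del_vertex (val (val P)) v == del_vertex (val (val R)) v).
Proof.
have delE P1 x y : x != v -> y != v ->
    same_part P1 x y = [exists C in del_vertex (val (val P1)) v, (x \in C) && (y \in C)].
  move=> xv yv; apply/idP/exists_inP => [Pxy|[C]].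
    exists (pblock (val (val P1)) x :\ v).
      rewrite !inE; apply/andP; split.
        by apply/set0Pn; exists x; rewrite !inE xv mem_pblock mem_coverP.
      by apply/imsetP; exists (pblock (val (val P1)) x) => //; apply/pblock_mem.
    by rewrite !inE xv yv mem_pblock mem_coverP.
  rewrite !inE => /andP[_ /imsetP[B PB ->]]; rewrite !inE => /andP[/andP[_ Bx] /andP[_ By]].
  by rewrite /same_part (mem_part PB Bx).
have sub P1 P2 : agree_off v P1 P2 ->
    del_vertex (val (val P1)) v \subset del_vertex (val (val P2)) v.
  move=> eqP12; apply/subsetP=> C; rewrite !inE => /andP[C0 /imsetP[B PB defC]].
  rewrite C0 /=; have /set0Pn[x] := C0; rewrite defC !inE => /andP[xv Bx].
  apply/imsetP; exists (pblock (val (val P2)) x); first exact/pblock_mem.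
  rewrite -(mem_part PB Bx); apply/setP => y; rewrite !inE.
  by case: eqP => //= /eqP yv; apply: eqP12.
apply: (iffP eqP) => [eqPR x y xv yv | eqPR]; first by rewrite !delE // eqPR.
by apply/eqP; rewrite eqEsubset !sub //; apply: agree_off_sym.
Qed.

Lemma upper_bell_adjP P R :
  reflect (P <> R /\ exists v, agree_off v P R) (adj P R).
Proof.
apply: (iffP andP) => [[/eqP PR /existsP[v /del_vertexP ?]]|[PR [v ?]]].
  by split; [move=> eqPR; apply: PR; rewrite eqPR | exists v].
split; first by apply/eqP => /val_inj.
by apply/existsP; exists v; apply/del_vertexP.
Qed.

Lemma part_of_rel (r : rel G) (S : {set G}) :
  equivalence_rel r -> (forall x y, r x y -> ~~ adj x y) ->
  {in S &, forall x y, r x y -> x = y} -> k <= #|S| ->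
  exists P, same_part P =2 r.
Proof.
move=> eqr indr Sr kS.
have eqrD : {in [set: G] & &, equivalence_rel r} by move=> x y z _ _ _; apply: eqr.
pose E := equivalence_partition r [set: G].
have pE : partition E [set: G] by apply: equivalence_partitionP.
have pbE x y : (y \in pblock E x) = r x y.
  by rewrite pblock_equivalence_partition ?inE.
have iE : indep_partition E.
  rewrite /indep_partition pE; apply/forall_inP => B EB; apply/forall_inP => x Bx.
  apply/forall_inP => y By; apply: indr; rewrite -pbE (def_pblock _ EB Bx) //.
  by case/and3P: pE.
pose E' : bell_graph G := exist (fun D => is_true (indep_partition D)) E iE.
have kE : E' \in [set P : bell_graph G | k <= #|val P|].
  rewrite inE /=; apply: leq_trans kS _.
  have injS : {in S &, injective (pblock E)}.
    move=> x y Sx Sy eqxy; apply: Sr => //; rewrite -pbE eqxy pbE.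
    by have [] := eqr y y y.
  rewrite -(card_in_imset injS); apply/subset_leq_card/subsetP => B /imsetP[x Sx ->].
  by apply: pblock_mem; rewrite (cover_partition pE) inE.
by exists (exist (fun D => is_true (D \in _)) E' kE) => x y; rewrite -pbE.
Qed.

Lemma refineP P (S : pred G) :
  exists R, forall x y, same_part R x y = same_part P x y && (S x == S y).
Proof.
have := transversalP (parts_partition P); set X := transversal _ _ => trX.
apply: (@part_of_rel _ X).
- move=> x y z; rewrite same_part_refl eqxx; split=> // /andP[Pxy /eqP->].
  congr (_ && _); apply/idP/idP; apply: same_part_trans => //.
  by rewrite same_part_sym.
- by move=> x y /andP[/same_part_nadj].
- move=> x y Xx Xy; rewrite same_partE => /andP[/eqP eqxy _].
  exact: (pblock_inj trX) eqxy.
by rewrite (card_transversal trX); have := valP P; rewrite inE.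
Qed.

End SamePart.

(** * Line-like partitions *)

Definition nonadj (G : sgraph) (x y : G) : bool := (x != y) && ~~ adj x y.

Lemma nonadj_sym (G : sgraph) : symmetric (@nonadj G).
Proof. by move=> x y; rewrite /nonadj eq_sym adj_sym. Qed.

Lemma nonadj_neq (G : sgraph) (x y : G) : nonadj x y -> x != y.
Proof. by case/andP. Qed.

(* Local properties of the partition into singletons that are invariant under
   graph isomorphism. A neighbour of that partition merges the two ends of a
   non-edge; being non-adjacent means that the two non-edges are disjoint, and
   the witness Z then merges both of them. *)
Record line_like (B : sgraph) (Q : B) : Prop := LineLike {
  ll_ex : forall X Y, adj Q X -> adj Q Y -> nonadj X Y ->
    exists Z, [/\ nonadj Q Z, adj Z X & adj Z Y];
  ll_uniq : forall X Y Z Z', adj Q X -> adj Q Y -> nonadj X Y ->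
    nonadj Q Z -> adj Z X -> adj Z Y -> nonadj Q Z' -> adj Z' X -> adj Z' Y ->
    Z = Z';
  ll_only : forall X Y Z W, adj Q X -> adj Q Y -> nonadj X Y ->
    nonadj Q Z -> adj Z X -> adj Z Y -> adj Q W -> adj Z W -> W = X \/ W = Y;
  ll_triangle : forall X Y W Z U, adj Q X -> adj Q Y -> adj Q W ->
    adj X Y -> adj X W -> adj Y W ->
    nonadj Q Z -> adj Z X -> adj Z Y -> adj Z W ->
    adj Q U -> adj U X -> ~ (nonadj U Y /\ nonadj U W);
  ll_matching : forall X Y U Z1 Z2, adj Q X -> adj Q Y -> adj Q U ->
    adj X Y -> nonadj U X -> nonadj U Y ->
    nonadj Q Z1 -> adj Z1 X -> adj Z1 U -> nonadj Q Z2 -> adj Z2 Y -> adj Z2 U ->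
    ~ nonadj Z1 Z2
}.

Lemma line_like_iso (B C : sgraph) (f : B -> C) (Q : B) : bijective f ->
  (forall X Y, adj (f X) (f Y) = adj X Y) -> line_like Q -> line_like (f Q).
Proof.
move=> bij_f adjf [ex uniq only tri mat].
have nf X Y : nonadj (f X) (f Y) = nonadj X Y.
  by rewrite /nonadj adjf (inj_eq (bij_inj bij_f)).
have [g fK gK] := bij_f.
split.
- move=> X Y; rewrite -(gK X) -(gK Y) !adjf nf => QX QY /(ex _ _ QX QY)[Z [??]].
  by exists (f Z); rewrite nf !adjf.
- move=> X Y Z Z'; rewrite -(gK X) -(gK Y) -(gK Z) -(gK Z') !adjf !nf.
  by move=> QX QY XY QZ ZX ZY QZ' Z'X Z'Y; rewrite (uniq _ _ _ _ QX QY XY QZ ZX ZY QZ').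
- move=> X Y Z W; rewrite -(gK X) -(gK Y) -(gK Z) -(gK W) !adjf !nf => QX QY XY QZ ZX ZY QW ZW.
  by case: (only _ _ _ _ QX QY XY QZ ZX ZY QW ZW) => ->; [left|right].
- move=> X Y W Z U; rewrite -(gK X) -(gK Y) -(gK Z) -(gK W) -(gK U) !adjf !nf.
  by move=> QX QY QW XY XW YW QZ ZX ZY ZW QU; apply: (tri _ _ _ _ _ QX QY QW XY XW YW QZ).
- move=> X Y U Z Z'; rewrite -(gK X) -(gK Y) -(gK Z) -(gK Z') -(gK U) !adjf !nf.
  by move=> QX QY QU XY UX UY QZ ZX ZU; apply: (mat _ _ _ _ _ QX QY QU XY UX UY QZ ZX ZU).
Qed.

Section Local.
Variables (G : sgraph) (k : nat).
Local Notation UB := (upper_bell k G).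
Local Notation sm := (@same_part G k).
Implicit Types (P Q R X Y Z : UB) (x y v : G).

Lemma adjI v p q P R : agree_off v P R -> sm P p q != sm R p q -> adj P R.
Proof.
move=> PR pq; apply/upper_bell_adjP; split; last by exists v.
by move=> eqPR; rewrite eqPR eqxx in pq.
Qed.

Lemma nonadjI P R : (exists p q, sm P p q != sm R p q) ->
  (forall v, exists p q, [/\ p != v, q != v & sm P p q != sm R p q]) -> nonadj P R.
Proof.
move=> [p [q /eqP pq]] nag; apply/andP; split.
  by apply/eqP => eqPR; case: pq; rewrite eqPR.
apply/upper_bell_adjP => -[_ [v ag]]; have [p' [q' [? ? /eqP[]]]] := nag v.
exact: ag.
Qed.

Lemma nonadj2 p q p' q' P R : sm P p q != sm R p q -> sm P p' q' != sm R p' q' ->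
  [&& p != p', p != q', q != p' & q != q'] -> nonadj P R.
Proof.
move=> dpq dpq' /and4P[pp pq qp qq]; apply: nonadjI; first by exists p, q.
move=> v; have [pv|pv] := eqVneq p v; first by exists p', q'; rewrite -pv eq_sym pp eq_sym pq.
have [qv|qv] := eqVneq q v; last by exists p, q.
by exists p', q'; rewrite -qv eq_sym qp eq_sym qq.
Qed.

Lemma nonadj3 p q r P R : sm P p q != sm R p q -> sm P p r != sm R p r ->
  sm P q r != sm R q r -> [&& p != q, p != r & q != r] -> nonadj P R.
Proof.
move=> dpq dpr dqr /and3P[pq pr qr]; apply: nonadjI; first by exists p, q.
move=> v; have [pv|pv] := eqVneq p v; first by exists q, r; rewrite -pv eq_sym pq eq_sym pr.
have [qv|qv] := eqVneq q v; last by exists p, q.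
by exists p, r; rewrite -qv pq eq_sym qr.
Qed.

Lemma adj_agree P R : adj P R -> exists v, agree_off v P R.
Proof. by case/upper_bell_adjP. Qed.

Lemma agree_off_nonadj v P R : agree_off v P R -> ~~ nonadj P R.
Proof.
move=> ag; apply/nandP; rewrite !negbK; case: eqP => PR; [by left | right].
by apply/upper_bell_adjP; split=> //; exists v.
Qed.

Definition is_split P b X :=
  forall x y, sm X x y = sm P x y && ((x == b) == (y == b)).

Lemma split_agree P b X : is_split P b X -> agree_off b P X.
Proof. by move=> XE p q pb qb; rewrite XE (negPf pb) (negPf qb) andbT. Qed.

Lemma split_adj P b d X : is_split P b X -> b != d -> sm P b d -> adj P X.
Proof.
move=> XE bd Pbd; apply: (adjI (split_agree XE) (p := b) (q := d)).
by rewrite XE Pbd eqxx (eq_sym d) (negPf bd).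
Qed.

Variable Q : UB.
Hypothesis llQ : line_like Q.

(* In a larger part, isolating b, or c, leaves two far common neighbours:
   isolate both, or split off {b, c}. *)
Lemma part_size_le3 b c d e : uniq [:: b; c; d; e] ->
  sm Q b c -> sm Q b d -> sm Q b e -> False.
Proof.
rewrite /= !inE !negb_or -!andbA => /and5P[bc bd be cd /and3P[ce de _]] Qbc Qbd Qbe.
have Qce : sm Q c e by rewrite same_part_sym in Qbc; apply: same_part_trans Qbc Qbe.
have bF z : b != z -> (z == b) = false by rewrite eq_sym => /negPf.
have cF z : c != z -> (z == c) = false by rewrite eq_sym => /negPf.
have [X XE] := refineP Q (pred1 b); have [Y YE] := refineP Q (pred1 c).
have [Z1 Z1E] := refineP X (pred1 c).
have [Z2 Z2E] := refineP Q [pred z | (z == b) || (z == c)].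
have simpE := (inE, (negPf bc, negPf bd, negPf be, negPf cd, negPf ce, negPf de),
  (bF c bc, bF d bd, bF e be, cF d cd, cF e ce), eqxx, Qbc, Qbd, Qbe, Qce).
have QX : adj Q X.
  apply: (@adjI b b d); last by rewrite XE /= !simpE.
  by move=> p q pb qb; rewrite XE /= (negPf pb) (negPf qb) andbT.
have QY : adj Q Y.
  apply: (@adjI c c e); last by rewrite YE /= !simpE.
  by move=> p q pb qb; rewrite YE /= (negPf pb) (negPf qb) andbT.
have XY : nonadj X Y.
  by apply: (@nonadj2 b d c e); rewrite ?XE ?YE /= !simpE.
have Z1X : adj Z1 X.
  apply: (@adjI c c e); last by rewrite Z1E XE /= !simpE.
  by move=> p q pb qb; rewrite Z1E /= (negPf pb) (negPf qb) andbT.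
have Z1Y : adj Z1 Y.
  apply: (@adjI b b d); last by rewrite Z1E XE YE /= !simpE.
  by move=> p q pb qb; rewrite Z1E XE YE /= (negPf pb) (negPf qb) andbT.
have Z2X : adj Z2 X.
  apply: (@adjI c b c); last by rewrite Z2E XE /= !simpE.
  by move=> p q pb qb; rewrite Z2E XE /= (negPf pb) (negPf qb) !orbF.
have Z2Y : adj Z2 Y.
  apply: (@adjI b b c); last by rewrite Z2E YE /= !simpE.
  by move=> p q pb qb; rewrite Z2E YE /= (negPf pb) (negPf qb).
have QZ1 : nonadj Q Z1.
  by apply: (@nonadj2 b d c e); rewrite ?Z1E ?XE /= !simpE.
have QZ2 : nonadj Q Z2.
  by apply: (@nonadj2 b d c e); rewrite ?Z2E /= !simpE.
have eqZ := ll_uniq llQ QX QY XY QZ1 Z1X Z1Y QZ2 Z2X Z2Y.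
by have := Z2E b c; rewrite -eqZ Z1E XE /= !simpE.
Qed.


Lemma part3E b c d z : uniq [:: b; c; d] -> sm Q b c -> sm Q b d -> sm Q b z ->
  z \in [:: b; c; d].
Proof.
move=> U Qbc Qbd Qbz; apply: contraT => nz; exfalso.
apply: (@part_size_le3 b c d z) => //.
by rewrite -[[:: b; c; d; z]]/(rcons [:: b; c; d] z) rcons_uniq nz.
Qed.

Lemma part3_split_agree w w' w'' Y1 Y2 : uniq [:: w; w'; w''] ->
  sm Q w w' -> sm Q w w'' -> is_split Q w Y1 -> is_split Q w' Y2 ->
  agree_off w'' Y1 Y2.
Proof.
move=> U Qw1 Qw2 Y1E Y2E; have wE := part3E U Qw1 Qw2.
move: U; rewrite /= !inE negb_or -!andbA => /and4P[w1 w2 w12 _].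
have simpE := (negPf w1, negPf w2, negPf w12,
  (eq_sym w' w, eq_sym w'' w, eq_sym w'' w'), eqxx, Qw1, Qw2).
move=> p q p2 q2; rewrite Y1E Y2E /=; case Qpq: (sm Q p q) => //=.
have [eqp|pw] := eqVneq p w.
  move: Qpq; rewrite eqp => /wE; rewrite !inE (negPf q2) orbF.
  by case/orP => /eqP ->; rewrite !simpE.
have [eqp|p1] := eqVneq p w'.
  move: Qpq; rewrite eqp => Qpq; have /wE := same_part_trans Qw1 Qpq.
  by rewrite !inE (negPf q2) orbF => /orP[]/eqP ->; rewrite !simpE.
have [eqq|qw] := eqVneq q w.
  move: Qpq; rewrite eqq same_part_sym => /wE.
  by rewrite !inE (negPf p2) (negPf p1) (negPf pw).
have [eqq|//] := eqVneq q w'.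
move: Qpq; rewrite eqq same_part_sym => Qpq; have /wE := same_part_trans Qw1 Qpq.
by rewrite !inE (negPf p2) (negPf p1) (negPf pw).
Qed.

Lemma part3_split_adj w w' w'' Y1 Y2 : uniq [:: w; w'; w''] ->
  sm Q w w' -> sm Q w w'' -> is_split Q w Y1 -> is_split Q w' Y2 -> adj Y1 Y2.
Proof.
move=> U Qw1 Qw2 Y1E Y2E.
apply: (adjI (part3_split_agree U Qw1 Qw2 Y1E Y2E) (p := w) (q := w'')).
move: U; rewrite /= !inE negb_or -!andbA => /and4P[w1 w2 w12 _].
by rewrite Y1E Y2E Qw2 eqxx ![w'' == _]eq_sym (negPf w1) (negPf w2) (negPf w12).
Qed.

Lemma absorb_part3 X v w w' w'' : agree_off v Q X -> sm X v w -> ~~ sm Q v w ->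
  uniq [:: w; w'; w''] -> sm Q w w' -> sm Q w w'' -> False.
Proof.
move=> QXv Xvw nQvw U Qw1 Qw2.
have Qw12 : sm Q w' w'' by rewrite same_part_sym in Qw1; apply: same_part_trans Qw1 Qw2.
have vw : v != w by apply: contraNneq nQvw => ->; apply: same_part_refl.
have nQv1 : ~~ sm Q v w'.
  by apply: contraNN nQvw => Qv1; apply: same_part_trans Qv1 _; rewrite same_part_sym.
have nQv2 : ~~ sm Q v w''.
  by apply: contraNN nQvw => Qv1; apply: same_part_trans Qv1 _; rewrite same_part_sym.
have v1 : v != w' by apply: contraNneq nQv1 => ->; apply: same_part_refl.
have v2 : v != w'' by apply: contraNneq nQv2 => ->; apply: same_part_refl.
have Xw1 : sm X w w' by rewrite -QXv // eq_sym.
have Xw2 : sm X w w'' by rewrite -QXv // eq_sym.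
have Xw12 : sm X w' w'' by rewrite -QXv // eq_sym.
have Xv1 : sm X v w' by apply: same_part_trans Xvw Xw1.
move: (U); rewrite /= !inE negb_or -!andbA => /and4P[w1 w2 w12 _].
have [Y1 Y1E] := refineP Q (pred1 w); have [Y2 Y2E] := refineP Q (pred1 w').
have [Z1 Z1E] := refineP X (pred1 w); have [Z2 Z2E] := refineP X (pred1 w').
have neF := (negPf vw, negPf v1, negPf v2, negPf w1, negPf w2, negPf w12,
  (eq_sym w v, eq_sym w' v, eq_sym w'' v, eq_sym w' w, eq_sym w'' w, eq_sym w'' w')).
have simpE := (neF, eqxx, Qw1, Qw2, Qw12, negPf nQvw, negPf nQv1, negPf nQv2,
   Xw1, Xw2, Xw12, Xvw, Xv1).
have QX : adj Q X by apply: (adjI QXv (p := v) (q := w)); rewrite !simpE.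
have QY1 : adj Q Y1 by apply: split_adj Y1E w1 Qw1.
have QY2 : adj Q Y2 by apply: (split_adj Y2E w12 Qw12).
have XZ1 : adj X Z1 by apply: split_adj Z1E w1 Xw1.
have XZ2 : adj X Z2 by apply: (split_adj Z2E w12 Xw12).
have Y12 : adj Y1 Y2 := part3_split_adj U Qw1 Qw2 Y1E Y2E.
have XY1 : nonadj X Y1.
  by apply: (@nonadj2 v w' w w''); rewrite ?Y1E /= !simpE.
have XY2 : nonadj X Y2.
  by apply: (@nonadj2 v w w' w''); rewrite ?Y2E /= !simpE.
have Z1Y1 : adj Z1 Y1.
  apply: (@adjI v v w'); last by rewrite Z1E Y1E /= !simpE.
  by move=> p q pv qv; rewrite Z1E Y1E QXv.
have Z2Y2 : adj Z2 Y2.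
  apply: (@adjI v v w); last by rewrite Z2E Y2E /= !simpE.
  by move=> p q pv qv; rewrite Z2E Y2E QXv.
have QZ1 : nonadj Q Z1.
  by apply: (@nonadj2 v w' w w''); rewrite ?Z1E /= !simpE.
have QZ2 : nonadj Q Z2.
  by apply: (@nonadj2 v w w' w''); rewrite ?Z2E /= !simpE.
rewrite adj_sym in XZ1; rewrite adj_sym in XZ2.
apply: (ll_matching llQ QY1 QY2 QX Y12 XY1 XY2 QZ1 Z1Y1 XZ1 QZ2 Z2Y2 XZ2).
by apply: (@nonadj2 v w' w w''); rewrite ?Z1E ?Z2E /= !simpE.
Qed.

Lemma absorb_part2 X v w w' : agree_off v Q X -> sm X v w -> ~~ sm Q v w ->
  w != w' -> sm Q w w' -> (forall z, sm Q w z -> z = w \/ z = w') -> False.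
Proof.
move=> QXv Xvw nQvw w1 Qw1 wE.
have vw : v != w by apply: contraNneq nQvw => ->; apply: same_part_refl.
have nQv1 : ~~ sm Q v w'.
  by apply: contraNN nQvw => Qv1; apply: same_part_trans Qv1 _; rewrite same_part_sym.
have v1 : v != w' by apply: contraNneq nQv1 => ->; apply: same_part_refl.
have wv : w != v by rewrite eq_sym.
have w1v : w' != v by rewrite eq_sym.
have Xw1 : sm X w w' by rewrite -QXv.
have Xv1 : sm X v w' by apply: same_part_trans Xvw Xw1.
have [Y YE] := refineP Q (pred1 w).
have neF := (negPf vw, negPf v1, negPf w1,
  (eq_sym w v, eq_sym w' v, eq_sym w' w)).
have simpE := (neF, eqxx, Qw1, negPf nQvw, negPf nQv1, Xw1, Xvw, Xv1).
have QX : adj Q X by apply: (adjI QXv (p := v) (q := w)); rewrite !simpE.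
have QY : adj Q Y by apply: split_adj YE w1 Qw1.
have XY : nonadj X Y by apply: (@nonadj3 v w w'); rewrite ?YE /= !simpE.
have Yw z : sm Y w z -> z = w.
  by rewrite YE /= eqxx eq_sym => /andP[_ /eqP/eqP].
have Yw' z : sm Y w' z -> z = w'.
  rewrite YE /= (eq_sym w') neF => /andP[Qz zw].
  by case: (wE z (same_part_trans Qw1 Qz)) => // zw'; rewrite zw' eqxx in zw.
have [/existsP[u /andP[uv Qvu]] | sv] := boolP [exists u, (u != v) && sm Q v u].
  have nXvu : ~~ sm X v u.
    apply: contraNN nQvw => Xvu; apply: same_part_trans Qvu _.
    by rewrite same_part_sym QXv // (same_part_trans _ Xvu) // same_part_sym.
  have uw : u != w by apply: contraNneq nXvu => ->.
  have u1 : u != w' by apply: contraNneq nXvu => ->.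
  have [Z1 Z1E] := refineP X (pred1 w); have [Z2 Z2E] := refineP X (pred1 w').
  have Z1X : adj Z1 X by rewrite adj_sym; apply: split_adj Z1E w1 Xw1.
  have Z2X : adj Z2 X.
    by rewrite adj_sym; apply: (split_adj Z2E (d := w)); rewrite 1?eq_sym // same_part_sym.
  have Z1Y : adj Z1 Y.
    apply: (@adjI v v w'); last by rewrite Z1E YE /= !simpE.
    by move=> p q pv qv; rewrite Z1E YE QXv.
  have Z2Y : adj Z2 Y.
    apply: (@adjI v v w); last by rewrite Z2E YE /= !simpE.
    move=> p q pv qv; rewrite Z2E YE QXv //=; case Xpq: (sm X p q) => //=.
    have Qpq : sm Q p q by rewrite QXv.
    have [pw|pw] := eqVneq p w; first by move: Qpq; rewrite pw => /wE[]->; rewrite !simpE.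
    have [qw|qw] := eqVneq q w.
      by move: Qpq; rewrite qw same_part_sym => /wE[] pE; [rewrite pE eqxx in pw | rewrite pE !simpE].
    have [pw'|pw'] := eqVneq p w'.
      case: (wE q); first by rewrite (same_part_trans Qw1) // -pw'.
        by move=> qw'; rewrite qw' eqxx in qw.
      by move->; rewrite eqxx.
    have [qw'|//] := eqVneq q w'.
    case: (wE p); first by rewrite (same_part_trans Qw1) // -qw' same_part_sym.
      by move=> pw2; rewrite pw2 eqxx in pw.
    by move=> pw2; rewrite pw2 eqxx in pw'.
  have dif : [&& w != v, w != u, w' != v & w' != u].
    by rewrite !neF (eq_sym w) (eq_sym w') uw u1.
  have QZ1 : nonadj Q Z1.
    by apply: (nonadj2 (p := w) (q := w') (p' := v) (q' := u) _ _ dif);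
      rewrite ?Z1E /= ?Qvu ?(negPf nXvu) ?simpE.
  have QZ2 : nonadj Q Z2.
    by apply: (nonadj2 (p := w) (q := w') (p' := v) (q' := u) _ _ dif);
      rewrite ?Z2E /= ?Qvu ?(negPf nXvu) ?simpE.
  have eqZ := ll_uniq llQ QX QY XY QZ1 Z1X Z1Y QZ2 Z2X Z2Y.
  by have := Z1E v w; rewrite eqZ Z2E /= !simpE.
have {}sv z : sm Q v z -> z = v.
  by move=> Qvz; apply/eqP; apply: contraNT sv => zv; apply/existsP; exists z; rewrite zv.
have [Z [QZ /adj_agree[x ZX] /adj_agree[y ZY]]] := ll_ex llQ QX QY XY.
have Yv z : sm Y v z -> z = v by rewrite YE => /andP[/sv].
have key a b : a != b -> v != a -> v != b -> (forall z, sm Q a z -> z = a \/ z = b) ->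
    (forall z, sm Y a z -> z = a) -> (forall z, sm Y b z -> z = b) ->
    sm X v a -> sm X v b -> agree_off a Z X -> False.
  move=> ab va vb aE Ya Yb Xva Xvb aZX.
  have Zvb : sm Z v b by rewrite aZX // eq_sym.
  have yvb : (y == v) || (y == b).
    apply: contraNT vb; rewrite negb_or => /andP[yv yb].
    by rewrite eq_sym; apply/eqP/Yv; rewrite -ZY // eq_sym.
  suff /agree_off_nonadj : agree_off b Q Z by rewrite QZ.
  have aux p : p != a -> p != b -> sm Q a p = sm Z a p.
    move=> pa pb; apply/idP/idP => [/aE[]/eqP|Zap]; rewrite ?(negPf pa) ?(negPf pb) //.
    have ay : a != y by case/orP: yvb => /eqP->; rewrite // eq_sym.
    have [py|py] := eqVneq p y; last by case/eqP: pa; apply: Ya; rewrite -ZY.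
    have yv : y = v by case/orP: yvb => /eqP // yb; rewrite -yb py eqxx in pb.
    have Zab : sm Z a b by apply: same_part_trans Zap _; rewrite py yv.
    have /Ya/eqP : sm Y a b by rewrite -ZY // yv eq_sym.
    by rewrite eq_sym (negPf ab).
  move=> p q pb qb.
  have [->|pa] := eqVneq p a; first by have [->|qa] := eqVneq q a; [rewrite !same_part_refl | apply: aux].
  have [->|qa] := eqVneq q a; first by rewrite same_part_sym aux // same_part_sym.
  have auxv r : r != a -> r != b -> sm Q v r = sm X v r.
    move=> ra rb; have [->|rv] := eqVneq r v; first by rewrite !same_part_refl.
    apply/idP/idP => [/sv/eqP|Xvr]; first by rewrite (negPf rv).
    have Qar : sm Q a r; last by case: (aE _ Qar) => /eqP; rewrite ?(negPf ra) ?(negPf rb).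
    by rewrite QXv 1?[a == v]eq_sym // (same_part_trans _ Xvr) // same_part_sym.
  rewrite aZX //.
  have [->|pv] := eqVneq p v; first exact: auxv.
  have [->|qv] := eqVneq q v; first by rewrite same_part_sym auxv // same_part_sym.
  exact: QXv.
have [xv|xv] := eqVneq x v.
  suff /agree_off_nonadj : agree_off v Q Z by rewrite QZ.
  by apply: agree_off_trans QXv _; apply: agree_off_sym; rewrite -xv.
have [xw|xw] := eqVneq x w.
  by apply: (key w w') => //; rewrite -xw.
have [xw'|xw'] := eqVneq x w'.
  apply: (key w' w) => //; rewrite 1?eq_sym //; last by rewrite -xw'.
  by move=> z Qz; case: (wE z (same_part_trans Qw1 Qz)); [right|left].
have Zvw : sm Z v w by rewrite ZX // eq_sym.
have Zvw' : sm Z v w' by rewrite ZX // eq_sym.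
have Zww' : sm Z w w' by rewrite ZX // eq_sym.
have [yv|yv] := eqVneq y v.
  have /Yw/eqP : sm Y w w' by rewrite -ZY // yv.
  by rewrite !neF.
have [yw|yw] := eqVneq y w.
  have /Yv/eqP : sm Y v w' by rewrite -ZY // yw // eq_sym.
  by rewrite !neF.
have /Yv/eqP : sm Y v w by rewrite -ZY // eq_sym.
by rewrite !neF.
Qed.

Lemma absorb X v w w' :
  agree_off v Q X -> sm X v w -> ~~ sm Q v w -> sm Q w w' -> w' = w.
Proof.
move=> QXv Xvw nQvw Qw1; apply/eqP; apply: contraT => ww'; exfalso.
have [/existsP[z /and3P[zw zw' Qz]] | nz] :=
  boolP [exists z, [&& z != w, z != w' & sm Q w z]].
  apply: (@absorb_part3 X v w w' z) => //=.
  by rewrite !inE negb_or ![w == _]eq_sym ww' zw [w' == z]eq_sym zw'.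
apply: (@absorb_part2 X v w w') => //; first by rewrite eq_sym.
move=> z Qz; move: nz; rewrite negb_exists => /forallP/(_ z); rewrite Qz andbT.
by case: eqP => [|_]; [left | case: eqP => //; right].
Qed.

End Local.

(** * Neighbours coded by non-edges *)

Lemma set2_inj (T : finType) (x y z t : T) : x != y -> [set x; y] = [set z; t] ->
  (x = z /\ y = t) \/ (x = t /\ y = z).
Proof.
move=> xy eqxy; have := set21 x y; have := set22 x y; rewrite eqxy !inE.
by case/orP => /eqP yE /orP[]/eqP xE; move: xy; rewrite xE yE ?eqxx //; [right | left].
Qed.

Lemma meetP (T : finType) (A B : {set T}) :
  reflect (exists2 z, z \in A & z \in B) (~~ [disjoint A & B]).
Proof.
apply: (iffP pred0Pn) => [[z /andP[]]|[z zA zB]]; first by exists z.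
by exists z; rewrite /= zA.
Qed.

Section Nonedges.
Variable G : sgraph.

Definition nonedges : {set {set G}} :=
  [set e | [exists x, exists y, nonadj x y && (e == [set x; y])]].

Lemma nonedgesP (e : {set G}) :
  reflect (exists x y, nonadj x y /\ e = [set x; y]) (e \in nonedges).
Proof.
rewrite inE; apply: (iffP existsP) => [[x /existsP[y /andP[xy /eqP]]]|[x [y [xy ->]]]].
  by exists x, y.
by exists x; apply/existsP; exists y; rewrite xy eqxx.
Qed.

Lemma mem_nonedges (x y : G) : nonadj x y -> [set x; y] \in nonedges.
Proof. by move=> xy; apply/nonedgesP; exists x, y. Qed.

Lemma nonedges_nonadj (x y : G) : [set x; y] \in nonedges -> x != y -> nonadj x y.
Proof.
case/nonedgesP => z [t [zt exy]] xy.
by have [[-> ->]|[-> ->]] := set2_inj xy exy; rewrite // nonadj_sym.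
Qed.

Lemma nonedge_eq (e : {set G}) x y :
  e \in nonedges -> x \in e -> y \in e -> x != y -> e = [set x; y].
Proof.
case/nonedgesP => z [t [_ ->]]; rewrite !inE => /orP[]/eqP-> /orP[]/eqP->; rewrite ?eqxx //.
by rewrite setUC.
Qed.

Lemma nonedge_mem (e : {set G}) x :
  e \in nonedges -> x \in e -> exists2 y, nonadj x y & e = [set x; y].
Proof.
case/nonedgesP => z [t [zt ->]]; rewrite !inE => /orP[]/eqP->; first by exists t.
by exists z; rewrite 1?nonadj_sym // setUC.
Qed.

End Nonedges.

Section Moves.
Variables (G : sgraph) (k : nat).
Local Notation UB := (upper_bell k G).
Local Notation sm := (@same_part G k).
Implicit Types (P Q R X Y Z : UB) (x y v : G) (e : {set G}).

Definition single Q x := [forall y, sm Q x y ==> (y == x)].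

Lemma singleP Q x : reflect (forall y, sm Q x y -> y = x) (single Q x).
Proof.
apply: (iffP forallP) => sx y; first by move/(implyP (sx y))/eqP.
by apply/implyP => /sx->.
Qed.

Definition is_part Q e := [forall x in e, forall y, sm Q x y == (y \in e)].

Lemma is_partP Q e :
  reflect (forall x y, x \in e -> sm Q x y = (y \in e)) (is_part Q e).
Proof.
apply: (iffP forall_inP) => [eP x y ex|eP x ex]; first by have/forallP/(_ y)/eqP := eP x ex.
by apply/forallP => y; rewrite eP.
Qed.

(* The move coded by the non-edge e: shatter e if it is a part, and otherwise
   make e a part. *)
Definition moved Q e x y : bool :=
  (x == y) || ((x \in e) == (y \in e)) && (if x \in e then ~~ is_part Q e else sm Q x y).

Definition codes Q X e := exists x y,
  [/\ nonadj x y, e = [set x; y], sm Q x y || single Q y & sm X =2 moved Q e].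

Lemma codes_nonedge Q X e : codes Q X e -> e \in nonedges G.
Proof. by case=> x [y [xy ->]] *; apply: mem_nonedges. Qed.

Lemma codes_inj Q X Y e : codes Q X e -> codes Q Y e -> X = Y.
Proof.
by case=> x [y [_ _ _ XE]] [z [t [_ _ _ YE]]]; apply: same_part_inj => p q; rewrite XE YE.
Qed.

Variable Q : UB.
Hypothesis llQ : line_like Q.

Lemma codes_gain X v w : agree_off v Q X -> sm X v w -> ~~ sm Q v w ->
  codes Q X [set v; w].
Proof.
move=> QXv Xvw nQvw.
have sw z : sm Q w z -> z = w := @absorb _ _ _ llQ _ _ _ _ QXv Xvw nQvw.
have vw : v != w by apply: contraNneq nQvw => <-; apply: same_part_refl.
have wv : w != v by rewrite eq_sym.
have nvw : nonadj v w by rewrite /nonadj vw (same_part_nadj Xvw).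
exists v, w; split=> //; first by apply/orP; right; apply/singleP.
have np : is_part Q [set v; w] = false.
  by apply/is_partP => /(_ v w); rewrite set21 set22 => /(_ isT); apply/negP.
have Xv z : sm X v z = (z == v) || (z == w).
  apply/idP/orP => [Xvz|[]/eqP->//]; last by apply: same_part_refl.
  have [?|zv] := eqVneq z v; [by left | right; apply/eqP/sw].
  by rewrite QXv // (same_part_trans _ Xvz) // same_part_sym.
have Xw z : sm X w z = (z == v) || (z == w).
  by rewrite -Xv; apply/idP/idP; apply: same_part_trans; rewrite // same_part_sym.
move=> p q; rewrite /moved np !inE.
have [->|pv] := eqVneq p v.
  by rewrite Xv /= [v == q]eq_sym; case: (q == v); case: (q == w).
have [->|pw] := eqVneq p w.
  by rewrite Xw /= [w == q]eq_sym; case: (q == v); case: (q == w).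
have [->|qv] := eqVneq q v.
  by rewrite same_part_sym Xv (negPf pv) (negPf pw).
have [->|qw] := eqVneq q w.
  by rewrite same_part_sym Xw (negPf pv) (negPf pw).
rewrite -QXv //=; have [->|//] := eqVneq p q; exact: same_part_refl.
Qed.

Lemma codes_split3 X v u z : is_split Q v X -> uniq [:: v; u; z] ->
  sm Q v u -> sm Q v z -> codes Q X [set u; z].
Proof.
move=> XE U Qvu Qvz; have vE := part3E llQ U Qvu Qvz.
move: U; rewrite /= !inE negb_or -!andbA => /and4P[vu vz uz _].
have Quz : sm Q u z by rewrite same_part_sym in Qvu; apply: same_part_trans Qvu Qvz.
exists u, z; split; rewrite ?Quz //; first by rewrite /nonadj uz (same_part_nadj Quz).
have np : is_part Q [set u; z] = false.
  by apply/is_partP => /(_ u v); rewrite set21 same_part_sym Qvu !inE (negPf vu) (negPf vz) => /(_ isT).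
have Qu q : sm Q u q = [|| q == v, q == u | q == z].
  apply/idP/idP => [Quq|]; first by have := vE q (same_part_trans Qvu Quq); rewrite !inE.
  by case/or3P => /eqP->; rewrite ?same_part_refl // same_part_sym.
have Qz q : sm Q z q = [|| q == v, q == u | q == z].
  rewrite -Qu; apply/idP/idP; apply: same_part_trans => //; by rewrite same_part_sym.
have Qv q : sm Q v q = [|| q == v, q == u | q == z].
  rewrite -Qu; apply/idP/idP; apply: same_part_trans => //; by rewrite same_part_sym.
move=> p q; rewrite XE /moved np !inE.
have [->|pu] := eqVneq p u.
  rewrite Qu [u == v]eq_sym (negPf vu) [u == q]eq_sym /=.
  have [->|_] := eqVneq q v; rewrite ?(negPf vu) ?(negPf vz) //=.
  by case: (q == u); case: (q == z).
have [->|pz] := eqVneq p z.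
  rewrite Qz [z == v]eq_sym (negPf vz) [z == q]eq_sym /=.
  have [->|_] := eqVneq q v; rewrite ?(negPf vu) ?(negPf vz) //=.
  by case: (q == u); case: (q == z).
have [->|pv] := eqVneq p v.
  rewrite Qv /= [v == q]eq_sym; have [->|_] //= := eqVneq q v.
  by case: (q == u); case: (q == z).
have [->|qv] := eqVneq q v.
  by rewrite same_part_sym Qv !(negPf pv, negPf pu, negPf pz) !andbF.
have [->|qu] := eqVneq q u.
  by rewrite same_part_sym Qu !(negPf pv, negPf pu, negPf pz).
have [->|qz] := eqVneq q z.
  by rewrite same_part_sym Qz !(negPf pv, negPf pu, negPf pz).
rewrite andbT /=; have [->|//] := eqVneq p q; exact: same_part_refl.
Qed.

Lemma codes_split2 X v u : is_split Q v X -> v != u ->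
  (forall z, sm Q v z = (z == v) || (z == u)) -> codes Q X [set v; u].
Proof.
move=> XE vu Qv; have Qvu : sm Q v u by rewrite Qv eqxx orbT.
exists v, u; split; rewrite ?Qvu //; first by rewrite /nonadj vu (same_part_nadj Qvu).
have Qu q : sm Q u q = (q == v) || (q == u).
  by rewrite -Qv; apply/idP/idP; apply: same_part_trans => //; rewrite same_part_sym.
have np : is_part Q [set v; u].
  by apply/is_partP => x y; rewrite !inE => /orP[]/eqP->; rewrite ?Qv ?Qu.
move=> p q; rewrite XE /moved np !inE.
have [->|pv] := eqVneq p v.
  rewrite Qv [v == q]eq_sym /=; have [//|qv] /= := eqVneq q v.
  by case: (q == u).
have [->|pu] := eqVneq p u.
  rewrite Qu [u == q]eq_sym /=; have [->|_] /= := eqVneq q v.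
    by rewrite (negPf vu).
  by case: (q == u).
have [->|qv] := eqVneq q v.
  by rewrite same_part_sym Qv !(negPf pv, negPf pu).
have [->|qu] := eqVneq q u.
  by rewrite same_part_sym Qu !(negPf pv, negPf pu).
rewrite andbT /=; have [->|//] := eqVneq p q; exact: same_part_refl.
Qed.

Lemma nbr_codes X : adj Q X -> exists e, codes Q X e.
Proof.
case/upper_bell_adjP => QX [v QXv].
have [/existsP[w /andP[Xvw nQvw]] | nex] := boolP [exists w, sm X v w && ~~ sm Q v w].
  by exists [set v; w]; apply: codes_gain.
have XQ w : sm X v w -> sm Q v w.
  by move: nex; rewrite negb_exists => /forallP/(_ w); case: (sm X v w); case: (sm Q v w).
have [/existsP[u /andP[Qvu nXvu]] | nex'] := boolP [exists w, sm Q v w && ~~ sm X v w]; last first.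
  case: QX; apply: same_part_inj => p q.
  have Xv w : sm Q v w = sm X v w.
    apply/idP/idP => [Qvw|/XQ//]; move: nex'; rewrite negb_exists => /forallP/(_ w).
    by rewrite Qvw negbK.
  have [->//|pv] := eqVneq p v; have [->|qv] := eqVneq q v; last exact: QXv.
  by rewrite same_part_sym Xv same_part_sym.
have vu : v != u by apply: contraNneq nXvu => ->; apply: same_part_refl.
have Xv w : sm X v w -> w = v.
  move=> Xvw; apply/eqP; apply: contraNT nXvu => wv; apply: (same_part_trans Xvw).
  rewrite -QXv // 1?eq_sym //; apply: (same_part_trans _ Qvu).
  by rewrite same_part_sym XQ.
have XE : is_split Q v X.
  move=> p q; have [->|pv] := eqVneq p v.
    have [->|qv] := eqVneq q v; first by rewrite !same_part_refl.
    by rewrite andbF; apply/negP => /Xv/eqP; apply/negP.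
  have [->|qv] := eqVneq q v; last by rewrite andbT QXv.
  by rewrite andbF same_part_sym; apply/negP => /Xv/eqP; apply/negP.
have [/existsP[z /and3P[zv zu Qvz]]|nz] := boolP [exists z, [&& z != v, z != u & sm Q v z]].
  exists [set u; z]; apply: (@codes_split3 _ v) => //.
  by rewrite /= !inE negb_or vu ![_ == z]eq_sym zv zu.
exists [set v; u]; apply: codes_split2 => // z; apply/idP/idP => [Qvz|].
  move: nz; rewrite negb_exists => /forallP/(_ z); rewrite Qvz andbT.
  by case: eqP; case: eqP.
by case/orP => /eqP-> //; apply: same_part_refl.
Qed.

End Moves.

Section Star.
Variables (G : sgraph) (k : nat).
Local Notation UB := (upper_bell k G).
Local Notation sm := (@same_part G k).
Implicit Types (P Q R X Y Z : UB) (x y v : G) (e : {set G}).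

Lemma star_center S Z v p1 p2 X1 X2 X3 x1 x2 x3 :
  v != p1 -> v != p2 -> p1 != p2 ->
  sm X1 v p1 -> ~~ sm X1 v p2 -> sm X2 v p2 -> ~~ sm X2 v p1 ->
  ~~ sm X3 v p1 -> ~~ sm X3 v p2 ->
  agree_off p1 X1 S -> agree_off p2 X2 S ->
  agree_off x1 Z X1 -> agree_off x2 Z X2 -> agree_off x3 Z X3 ->
  x1 != v -> x2 != v -> x3 != v ->
  agree_off p1 Z S /\ agree_off p2 Z S.
Proof.
move=> vp1 vp2 p12 X1p1 X1p2 X2p2 X2p1 X3p1 X3p2 XS1 XS2 ZX1 ZX2 ZX3 x1v x2v x3v.
have vx1 : v != x1 by rewrite eq_sym.
have vx2 : v != x2 by rewrite eq_sym.
have vx3 : v != x3 by rewrite eq_sym.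
suff [e1 e2] : p1 = x1 /\ p2 = x2.
  by split; [apply: (agree_off_trans _ XS1); rewrite e1
            | apply: (agree_off_trans _ XS2); rewrite e2].
have gain (x y : G) (X : UB) : agree_off y Z X -> v != y -> sm Z v x -> ~~ sm X v x -> x = y.
  move=> ZX vy Zvx; apply: contraNeq => xy; by rewrite -ZX.
have p1x1 : p1 = x1.
  apply/eqP; apply: contraT => p1x1; exfalso.
  have Zp1 : sm Z v p1 by rewrite ZX1.
  have p1x2 := gain _ _ _ ZX2 vx2 Zp1 X2p1.
  have p1x3 := gain _ _ _ ZX3 vx3 Zp1 X3p1.
  have Zp2 : sm Z v p2 by rewrite ZX2 // -p1x2 eq_sym.
  by have /eqP := gain _ _ _ ZX3 vx3 Zp2 X3p2; rewrite -p1x3 eq_sym (negPf p12).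
split=> //; apply/eqP; apply: contraT => p2x2; exfalso.
have Zp2 : sm Z v p2 by rewrite ZX2.
have p2x1 := gain _ _ _ ZX1 vx1 Zp2 X1p2.
by move: p12; rewrite p2x1 p1x1 eqxx.
Qed.

Lemma moved_row Q X v p : sm X =2 moved Q [set v; p] ->
  forall x y, x != v -> y != v ->
  sm X x y = (x == y) || [&& x != p, y != p & sm Q x y].
Proof.
move=> XE x y xv yv; rewrite XE /moved !inE (negPf xv) (negPf yv) /=.
have [->|xp] := eqVneq x p.
  by rewrite eq_sym /=; case: (y == p).
by case: (y == p).
Qed.

Lemma moved_agree Q X v p : sm X =2 moved Q [set v; p] -> single Q p ->
  agree_off v X Q.
Proof.
move=> XE /singleP sp x y xv yv; rewrite (moved_row XE) //.
have [->|xy] := eqVneq x y; first by rewrite same_part_refl.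
have [xp|xp] /= := eqVneq x p.
  by apply/esym/negP => /[!xp] /sp yx; rewrite yx xp eqxx in xy.
have [yp|//] /= := eqVneq y p.
by apply/esym/negP; rewrite yp same_part_sym => /sp xy'; rewrite xy' eqxx in xp.
Qed.

Lemma moved_split_agree Q X S v p : sm X =2 moved Q [set v; p] -> is_split Q v S ->
  agree_off p X S.
Proof.
rewrite setUC => XE SE x y xp yp; rewrite (moved_row XE) // SE.
have [->|xv] := eqVneq x v.
  have [->|yv] := eqVneq y v; first by rewrite same_part_refl eqxx.
  by rewrite andbF.
have [->|yv] := eqVneq y v; first by rewrite (negPf xv); case: (sm Q x v).
by rewrite andbT; case: eqP => // ->; rewrite same_part_refl.
Qed.

Lemma moved_pair Q X v p : sm X =2 moved Q [set v; p] -> v != p -> ~~ sm Q v p -> sm X v p.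
Proof.
move=> XE vp nQ; rewrite XE /moved !inE !eqxx orbT /=.
apply/orP; right; apply: contraNN nQ => /is_partP/(_ v p) ->; by rewrite !inE eqxx ?orbT.
Qed.

Lemma moved_out Q X e x y : sm X =2 moved Q e -> x \in e -> y \notin e -> ~~ sm X x y.
Proof.
move=> XE ex ey; rewrite XE /moved ex (negPf ey) orbF.
by apply: contraNneq ey => <-.
Qed.

End Star.

Section Full.
Variables (G : sgraph) (k : nat).
Local Notation UB := (upper_bell k G).
Local Notation sm := (@same_part G k).
Implicit Types (P R X Y Z : UB) (x y v : G) (e : {set G}).

(* Every line-like Q has at most as many neighbours as there are non-edges, by
   nbr_codes and codes_inj; Q is full in the case of equality. *)
Definition full (Q : UB) := forall x y, nonadj x y ->
  exists X, adj Q X /\ codes Q X [set x; y].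

Variable Q : UB.
Hypothesis llQ : line_like Q.
Hypothesis fullQ : full Q.

Lemma full_moved x y : nonadj x y -> exists X, adj Q X /\ sm X =2 moved Q [set x; y].
Proof. by case/fullQ => X [QX [z [t [_ _ _ XE]]]]; exists X. Qed.

Lemma nonadj_single x y : nonadj x y -> [|| sm Q x y, single Q x | single Q y].
Proof.
move=> xy; have [X [_ [z [t [_ exy st _]]]]] := fullQ xy.
case: (set2_inj (nonadj_neq xy) exy) => -[-> ->]; last rewrite same_part_sym.
  by case/orP: st => ->; rewrite ?orbT.
by case/orP: st => ->; rewrite ?orbT.
Qed.

Lemma single_out x y : x != y -> single Q x -> ~~ sm Q x y.
Proof. by move=> xy /singleP sx; apply: contraNN xy => /sx->. Qed.

Lemma part_nsingle x y : x != y -> sm Q x y -> single Q x = false.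
Proof. by move=> xy Qxy; apply: contraTF Qxy; apply: single_out. Qed.

Lemma part3_closed a b c v : uniq [:: a; b; c] -> sm Q a b -> sm Q a c ->
  nonadj a v -> v \in [:: a; b; c].
Proof.
move=> U Qab Qac av; apply: contraT => vn; exfalso.
have aE z := part3E llQ U Qab Qac (z := z).
have nQav : ~~ sm Q a v by apply: contraNN vn => /aE.
have vb : v != b by apply: contraNneq vn => ->; rewrite !inE eqxx orbT.
have vc : v != c by apply: contraNneq vn => ->; rewrite !inE eqxx !orbT.
have nav := nonadj_neq av.
move: (U); rewrite /= !inE negb_or -!andbA => /and4P[ab ac bc _].
have sv : single Q v.
  by have := nonadj_single av; rewrite (negPf nQav) (part_nsingle ab Qab).
have [X [QX XE]] := full_moved av.
have Xav := moved_pair XE nav nQav.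
have ba : b != a by rewrite eq_sym.
have ca : c != a by rewrite eq_sym.
have bv : b != v by rewrite eq_sym.
have cv : c != v by rewrite eq_sym.
have Qbc : sm Q b c by apply: same_part_trans Qac; rewrite same_part_sym.
have Xbc : sm X b c by rewrite (moved_agree XE).
have Qba : sm Q b a by rewrite same_part_sym.
have Qca : sm Q c a by rewrite same_part_sym.
have [A AE] := refineP Q (pred1 a); have [B BE] := refineP Q (pred1 b).
have [C CE] := refineP Q (pred1 c); have [Z ZE] := refineP A (pred1 b).
have neF := (negPf ab, negPf ac, negPf bc, negPf ba, negPf ca,
  (eq_sym c b), eqxx, Qab, Qac, Qbc, Qba, Qca).
have QA : adj Q A := split_adj AE ab Qab.
have QB : adj Q B := split_adj BE ba Qba.
have QC : adj Q C := split_adj CE ca Qca.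
have AB : adj A B := part3_split_adj llQ U Qab Qac AE BE.
have AC : adj A C.
  apply: (part3_split_adj llQ _ Qac Qab AE CE).
  by rewrite /= !inE !neF.
have BC : adj B C.
  apply: (part3_split_adj llQ _ Qbc Qba BE CE).
  by rewrite /= !inE !neF.
have Aag := split_agree AE.
have ZA : adj Z A.
  by rewrite adj_sym; apply: (split_adj ZE bc); rewrite -Aag.
have ZB : adj Z B.
  apply: (@adjI G k a a c); last by rewrite ZE AE BE /= !neF.
  by move=> p q pa qa; rewrite ZE BE -Aag.
have ZC : adj Z C.
  apply: (@adjI G k a a b); last by rewrite ZE AE CE /= !neF.
  apply: agree_off_trans (part3_split_agree llQ _ Qbc Qba BE CE).
    by move=> p q pa qa; rewrite ZE BE -Aag.
  by rewrite /= !inE !neF.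
have QZ : nonadj Q Z.
  by apply: (@nonadj3 G k a b c); rewrite ?ZE ?AE /= !neF.
have XA : adj X A.
  apply: (@adjI G k a a v); last by rewrite Xav AE (negPf nQav).
  exact: agree_off_trans (moved_agree XE sv) Aag.
apply: (ll_triangle llQ QA QB QC AB AC BC QZ ZA ZB ZC QX XA); split.
  by apply: (@nonadj2 G k a v b c); rewrite ?BE ?(negPf nQav) ?Xav ?Xbc /= ?neF // vb vc.
apply: (@nonadj2 G k a v b c); rewrite ?CE ?(negPf nQav) ?Xav ?Xbc /= ?neF // ?vb ?vc //.
Qed.

(* When w is not a singleton either, moving a to v and moving w to v have no far
   common neighbour. *)
Lemma nonsingle_closed a b v w : a != b -> sm Q a b ->
  nonadj a v -> ~~ sm Q a v -> nonadj v w -> sm Q a w.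
Proof.
move=> ab Qab av nQav vw; apply: contraT => nQaw; exfalso.
have sv : single Q v.
  by have := nonadj_single av; rewrite (negPf nQav) (part_nsingle ab Qab).
have nav := nonadj_neq av; have nvw := nonadj_neq vw.
have naw : a != w by apply: contraNneq nQaw => <-; apply: same_part_refl.
have nvb : v != b by apply: contraNneq nQav => ->.
have nwb : w != b by apply: contraNneq nQaw => ->.
have va : v != a by rewrite eq_sym.
have wa : w != a by rewrite eq_sym.
have ba : b != a by rewrite eq_sym.
have nQvw := single_out nvw sv.
have [X [QX XE]] := full_moved av.
have Xav := moved_pair XE nav nQav.
have XQ := moved_agree XE sv.
have [/singleP sw|] := boolP (single Q w).
  have [Y [QY YE]] := full_moved vw.
  have YQ : agree_off v Y Q by apply: moved_agree YE _; apply/singleP.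
  have Yvw := moved_pair YE nvw nQvw.
  have Yab : sm Y a b by rewrite YQ // eq_sym.
  have [S SE] := refineP Q (pred1 a); have [Z ZE] := refineP Y (pred1 a).
  have neF := (negPf nav, negPf va, negPf naw, negPf wa, negPf ab, negPf ba,
    negPf nQvw, negPf nQav, Yab, Yvw, Qab, eqxx).
  have QS : adj Q S := split_adj SE ab Qab.
  have SY : nonadj S Y.
    apply: (@nonadj2 G k a b v w); rewrite ?SE /= ?neF //.
    by rewrite eq_sym nvb eq_sym nwb.
  have ZS : adj Z S.
    apply: (@adjI G k v v w); last by rewrite ZE SE /= !neF.
    by move=> p q pv qv; rewrite ZE SE YQ.
  have ZY : adj Z Y by rewrite adj_sym (split_adj ZE ab).
  have QZ : nonadj Q Z.
    apply: (@nonadj2 G k a b v w); rewrite ?ZE /= ?neF //.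
    by rewrite eq_sym nvb eq_sym nwb.
  have ZX : adj Z X.
    apply: (@adjI G k v a v); last by rewrite ZE Xav /= !neF andbF.
    move=> p q pv qv; rewrite setUC in XE; rewrite ZE (moved_row XE) // YQ //=.
    have [->|pa] := eqVneq p a; first have [->|qa] := eqVneq q a.
    - by rewrite same_part_refl eqxx.
    - by rewrite andbF.
    have [->|qa] := eqVneq q a; first by rewrite (negPf pa) andbF.
    by rewrite andbT; case: eqP => // ->; rewrite same_part_refl.
  case: (ll_only llQ QS QY SY QZ ZS ZY QX ZX) => XE'.
    by move: Xav; rewrite XE' SE (negPf nQav).
  by move: (moved_out YE (set21 _ _) (y := a)); rewrite !inE !neF -XE' same_part_sym Xav => /(_ isT).
rewrite negb_forall => /existsP[d]; rewrite negb_imply => /andP[Qwd dw].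
have wv : nonadj w v by rewrite nonadj_sym.
have nwv := nonadj_neq wv.
have nQwv : ~~ sm Q w v by rewrite same_part_sym.
have [Y [QY YE]] := full_moved wv.
have Ywv := moved_pair YE nwv nQwv.
have YQ := moved_agree YE sv.
have nad : a != d by apply: contraNneq nQaw => ->; rewrite same_part_sym.
have nbd : b != d.
  apply: contraNneq nQaw => bd; apply: (same_part_trans Qab).
  by rewrite bd same_part_sym.
have nvd : v != d by apply: contraNneq nQwv => ->.
have Xwd : sm X w d by rewrite XQ // eq_sym.
have Yab : sm Y a b by rewrite YQ // eq_sym.
have nXab : ~~ sm X a b by apply: (moved_out XE); rewrite !inE ?eqxx // negb_or ba eq_sym.
have nXwv : ~~ sm X w v.
  by rewrite same_part_sym; apply: (moved_out XE); rewrite !inE ?eqxx ?orbT // negb_or wa.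
have nYav : ~~ sm Y a v.
  by rewrite same_part_sym; apply: (moved_out YE); rewrite !inE ?eqxx ?orbT // negb_or naw.
have nYwd : ~~ sm Y w d.
  by apply: (moved_out YE); rewrite !inE ?eqxx // negb_or dw eq_sym.
have XY : nonadj X Y.
  apply: (@nonadj2 G k a v w d); rewrite ?Xav ?Xwd ?(negPf nYav) ?(negPf nYwd) //.
  by rewrite naw nad nvw nvd.
have [Z [QZ /adj_agree[x ZX] /adj_agree[y ZY]]] := ll_ex llQ QX QY XY.
have cover p q : sm X p q != sm Y p q -> [|| p == x, q == x, p == y | q == y].
  apply: contraNT; rewrite !negb_or => /and4P[px qx py qy].
  by rewrite -ZX // -ZY.
have := cover a v; rewrite Xav (negPf nYav) => /(_ isT) c1.
have := cover w d; rewrite Xwd (negPf nYwd) => /(_ isT) c2.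
have := cover a b; rewrite Yab (negPf nXab) => /(_ isT) c3.
have := cover w v; rewrite Ywv (negPf nXwv) => /(_ isT) c4.
have neF := (negPf nav, negPf va, negPf naw, negPf wa, negPf ab, negPf ba,
  negPf nvw, negPf nwv, negPf nvb, negPf nwb, negPf nad, negPf nbd, negPf nvd, eqxx,
  (eq_sym b w, eq_sym b v, eq_sym d a, eq_sym d b, eq_sym d v, negPf dw, eq_sym w d)).
have [xa|xa] := eqVneq x a.
  suff /agree_off_nonadj : agree_off a Q Z by rewrite QZ.
  by apply: agree_off_sym; apply: (agree_off_trans _ XQ); rewrite -xa.
have [xw|xw] := eqVneq x w.
  have ya : y = a.
    apply/eqP; move: c1 c3; rewrite xw !neF /= ![_ == y]eq_sym; case: (y == a) => //=.
    by move/eqP->; rewrite !neF.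
  have Zav : sm Z a v by rewrite ZX ?xw.
  have Zwv : sm Z w v by rewrite ZY ?ya.
  have Zaw : sm Z a w by apply: (same_part_trans Zav); rewrite same_part_sym.
  have := @nonadj_single a w; rewrite /nonadj naw (same_part_nadj Zaw) => /(_ isT).
  rewrite (negPf nQaw) (part_nsingle ab Qab) /=; apply/negP.
  by rewrite (part_nsingle _ Qwd) // eq_sym.
move: c1 c2 c3 c4; rewrite ![_ == x]eq_sym ![_ == y]eq_sym (negPf xa) (negPf xw) /=.
have [->|xv] := eqVneq x v; rewrite ?neF /=.
  move=> _ /orP[]/eqP->; by rewrite ?neF.
move=> /orP[]/eqP->; rewrite !neF /= ?orbF.
  by [].
by move=> /eqP->; rewrite !neF.
Qed.

Lemma meet_agree v p q X Y : nonadj v p -> nonadj v q -> p != q ->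
  sm X =2 moved Q [set v; p] -> sm Y =2 moved Q [set v; q] -> agree_off v X Y.
Proof.
have near a b r : nonadj v a -> nonadj v b -> a != b -> sm Q a r ->
    [|| r == v, r == a | r == b].
  move=> va vb ab Qar; apply: contraT; rewrite !negb_or => /and3P[rv ra rb]; exfalso.
  have nva := nonadj_neq va; have nvb := nonadj_neq vb.
  have av : nonadj a v by rewrite nonadj_sym.
  have ar : a != r by rewrite eq_sym.
  have [Qav|nQav] := boolP (sm Q a v).
    have Qva : sm Q v a by rewrite same_part_sym.
    have := @part3_closed v a r b _ Qva (same_part_trans Qva Qar) vb.
    rewrite /= !inE negb_or nva ![v == r]eq_sym rv ar => /(_ isT).
    by rewrite [b == v]eq_sym (negPf nvb) [b == a]eq_sym (negPf ab) [b == r]eq_sym (negPf rb).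
  have Qab := nonsingle_closed ar Qar av nQav vb.
  have := @part3_closed a r b v _ Qar Qab av.
  rewrite /= !inE negb_or ar ab rb => /(_ isT).
  by rewrite (negPf nva) [v == r]eq_sym (negPf rv) (negPf nvb).
move=> vp vq pq XE YE x y xv yv; rewrite (moved_row XE) // (moved_row YE) //.
have [//|xy] /= := eqVneq x y; case Qxy: (sm Q x y); rewrite ?andbF ?andbT //.
have qp : q != p by rewrite eq_sym.
have [xp|xp] /= := eqVneq x p.
  have := near p q y vp vq pq; rewrite -xp Qxy (negPf yv) eq_sym (negPf xy) => /(_ isT) /= /eqP->.
  by rewrite eqxx andbF.
have [xq|xq] /= := eqVneq x q.
  have := near q p y vq vp qp; rewrite -xq Qxy (negPf yv) eq_sym (negPf xy) => /(_ isT) /= /eqP->.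
  by rewrite eqxx.
have Qyx : sm Q y x by rewrite same_part_sym.
have [yp|yp] /= := eqVneq y p.
  have := near p q x vp vq pq; rewrite -yp Qyx (negPf xv) (negPf xy) => /(_ isT) /= /eqP xq'.
  by rewrite xq' eqxx in xq.
have [yq|//] /= := eqVneq y q.
have := near q p x vq vp qp; rewrite -yq Qyx (negPf xv) (negPf xy) => /(_ isT) /= /eqP xp'.
by rewrite xp' eqxx in xp.
Qed.

Lemma moved_change e f X Y : e \in nonedges G -> f \in nonedges G -> [disjoint e & f] ->
  sm X =2 moved Q e -> sm Y =2 moved Q f ->
  exists p q, [/\ sm X p q != sm Q p q, sm Y p q = sm Q p q, p \in e, q \notin f &
    q \in e \/ sm Q p q /\ (exists r, [/\ uniq [:: p; r; q], sm Q p r & r \in e])].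
Proof.
move=> /nonedgesP[x [y [xy ->]]] fn dis XE YE.
have nxy := nonadj_neq xy.
have out z : z \in [set x; y] -> z \in f = false by apply: disjointFr dis.
have YQ p q : p \notin f -> q \notin f -> sm Y p q = sm Q p q.
  move=> pf qf; rewrite YE /moved (negPf pf) (negPf qf) eqxx /=.
  by case: eqP => // ->; rewrite same_part_refl.
have [xf yf] : x \notin f /\ y \notin f by rewrite !out ?set21 ?set22.
have [Qxy|nQxy] := boolP (sm Q x y); last first.
  exists x, y; rewrite (YQ x y) // (moved_pair XE) // (negPf nQxy) set21 yf.
  by split=> //; left; apply: set22.
have [ip|nip] := boolP (is_part Q [set x; y]).
  exists x, y; rewrite (YQ x y) // XE /moved ip Qxy set21 set22 (negPf nxy) /= yf.
  by split=> //; left.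
have [/existsP[u /and3P[ux uy Qxu]]|nex] := boolP [exists u, [&& u != x, u != y & sm Q x u]].
  have U : uniq [:: x; y; u] by rewrite /= !inE negb_or nxy ![_ == u]eq_sym ux uy.
  have uf : u \notin f.
    apply/negP => uf; have [w uw fE] := nonedge_mem fn uf.
    have Qux : sm Q u x by rewrite same_part_sym.
    have : w \in [:: u; x; y].
      apply: part3_closed Qux (same_part_trans Qux Qxy) uw.
      by rewrite /= !inE negb_or ux uy nxy.
    have wf : w \in f by rewrite fE set22.
    rewrite !inE; case/or3P => /eqP wE.
    - by have := nonadj_neq uw; rewrite wE eqxx.
    - by rewrite -wE wf in xf.
    - by rewrite -wE wf in yf.
  exists x, u; rewrite (YQ x u) // Qxu set21 uf.
  split=> //; last by right; split=> //; exists y; rewrite set22.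
  have := moved_out XE (set21 x y) (y := u); rewrite !inE negb_or ux uy => /(_ isT).
  by move/negPf->.
case/negP: nip; have Qx z : sm Q x z = (z == x) || (z == y).
  apply/idP/idP => [Qxz|/orP[]/eqP->//]; last exact: same_part_refl.
  move: nex; rewrite negb_exists => /forallP/(_ z); rewrite Qxz andbT.
  by case: eqP => //; case: eqP.
apply/is_partP => a b; rewrite !inE => /orP[]/eqP->; rewrite -?Qx //.
by apply/idP/idP; apply: same_part_trans; rewrite // same_part_sym.
Qed.

Lemma disjoint_nonadj e f X Y : e \in nonedges G -> f \in nonedges G -> [disjoint e & f] ->
  sm X =2 moved Q e -> sm Y =2 moved Q f -> nonadj X Y.
Proof.
move=> en fn dis XE YE; have dis' : [disjoint f & e] by rewrite disjoint_sym.
have [p [q [Xpq Ypq pe qf qe]]] := moved_change en fn dis XE YE.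
have [r [s [Yrs Xrs rf se sf]]] := moved_change fn en dis' YE XE.
apply: (@nonadj2 G k p q r s); rewrite ?Ypq ?Xrs //; first by rewrite eq_sym.
have neq a b : a \in e -> b \in f -> a != b.
  by move=> ae bf; apply: contraTneq ae => ->; rewrite (disjointFr dis').
apply/and4P; split; [exact: neq | | |].
- by apply: contraTneq pe => ->.
- by apply: contraTneq rf => <-.
case: qe => [qe|[Qpq [t [U Qpt te]]]]; first by apply: contraTneq qe => ->.
case: sf => [sf|[Qrs [u [_ Qru uf]]]]; first by apply: contraTneq sf => <-.
apply/eqP => qs; rewrite -qs same_part_sym in Qrs.
have := part3E llQ U Qpt Qpq (same_part_trans Qpq Qrs).
rewrite !inE eq_sym (negPf (neq p r pe rf)) eq_sym (negPf (neq t r te rf)) /= => /eqP rq.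
by rewrite -rq rf in qf.
Qed.

Lemma star_nonsingle v p q r : uniq [:: p; q; r] ->
  nonadj v p -> nonadj v q -> nonadj v r -> ~~ single Q p -> sm Q v p.
Proof.
move=> U vp vq vr; rewrite negb_forall => /existsP[d].
rewrite negb_imply eq_sym => /andP[Qpd pd]; apply: contraT => nQvp; exfalso.
have pv : nonadj p v by rewrite nonadj_sym.
have nQpv : ~~ sm Q p v by rewrite same_part_sym.
have Qpq := nonsingle_closed pd Qpd pv nQpv vq.
have Qpr := nonsingle_closed pd Qpd pv nQpv vr.
have := part3_closed U Qpq Qpr pv.
by rewrite !inE (negPf (nonadj_neq vp)) (negPf (nonadj_neq vq)) (negPf (nonadj_neq vr)).
Qed.

Lemma star_single2 v p q r : uniq [:: p; q; r] ->
  nonadj v p -> nonadj v q -> nonadj v r -> ~~ single Q p -> single Q q.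
Proof.
move=> U vp vq vr sp; apply: contraT => sq.
have Qvp := star_nonsingle U vp vq vr sp.
move: (U); rewrite /= !inE negb_or -!andbA => /and4P[pq pr qr _].
have Qvq : sm Q v q.
  by apply: (@star_nonsingle v q p r); rewrite //= !inE negb_or qr pr eq_sym pq.
have := @part3_closed v p q r _ Qvp Qvq vr.
rewrite /= !inE negb_or (nonadj_neq vp) (nonadj_neq vq) pq => /(_ isT).
rewrite ![r == _]eq_sym (negPf pr) (negPf qr) !orbF => /eqP vr'.
by move: (nonadj_neq vr); rewrite vr' eqxx.
Qed.

Lemma star_single_nbrs v p1 p2 p3 X1 X2 X3 Z : uniq [:: p1; p2; p3] ->
  nonadj v p1 -> nonadj v p2 -> nonadj v p3 -> single Q p1 -> single Q p2 ->
  sm X1 =2 moved Q [set v; p1] -> sm X2 =2 moved Q [set v; p2] ->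
  sm X3 =2 moved Q [set v; p3] ->
  adj Z X1 -> adj Z X2 -> adj Z X3 -> ~~ nonadj Q Z.
Proof.
move=> U v1 v2 v3 s1 s2 X1E X2E X3E.
move=> /adj_agree[x1 ZX1] /adj_agree[x2 ZX2] /adj_agree[x3 ZX3].
move: (U); rewrite /= !inE negb_or -!andbA => /and4P[p12 p13 p23 _].
have p21 : p2 != p1 by rewrite eq_sym.
have p31 : p3 != p1 by rewrite eq_sym.
have p32 : p3 != p2 by rewrite eq_sym.
have X1Q := moved_agree X1E s1; have X2Q := moved_agree X2E s2.
have X3Q : agree_off v X3 Q := agree_off_trans (meet_agree v3 v1 p31 X3E X1E) X1Q.
have final X : agree_off v Z X -> agree_off v X Q -> ~~ nonadj Q Z.
  by move=> ZX XQ; apply: (@agree_off_nonadj _ _ v); apply/agree_off_sym/(agree_off_trans ZX).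
have [xv|x1v] := eqVneq x1 v; first by apply: final X1Q; rewrite -xv.
have [xv|x2v] := eqVneq x2 v; first by apply: final X2Q; rewrite -xv.
have [xv|x3v] := eqVneq x3 v; first by apply: final X3Q; rewrite -xv.
have [S SE] := refineP Q (pred1 v).
have vp1 := nonadj_neq v1; have vp2 := nonadj_neq v2; have vp3 := nonadj_neq v3.
have nQv p : nonadj v p -> single Q p -> ~~ sm Q v p.
  by move=> vp sp; rewrite same_part_sym single_out // eq_sym nonadj_neq.
have out X p q : sm X =2 moved Q [set v; p] -> q != p -> v != q -> ~~ sm X v q.
  by move=> XE qp vq; apply: (moved_out XE); rewrite !inE ?eqxx // negb_or eq_sym vq.
have [ZS1 ZS2] : agree_off p1 Z S /\ agree_off p2 Z S.
  by apply: (star_center vp1 vp2 p12 (moved_pair X1E vp1 (nQv _ v1 s1)) (out _ _ _ X1E p21 vp2)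
    (moved_pair X2E vp2 (nQv _ v2 s2)) (out _ _ _ X2E p12 vp1)
    (out _ _ _ X3E p13 vp1) (out _ _ _ X3E p23 vp2)
    (moved_split_agree X1E SE) (moved_split_agree X2E SE) ZX1 ZX2 ZX3).
have nQ12 := single_out p12 s1.
have [Z12|nZ12] := boolP (sm Z p1 p2); last first.
  apply: (final S); last exact: agree_off_sym (split_agree SE).
  move=> x y xv yv.
  have [xp1|xp1] := eqVneq x p1; last have [yp1|yp1] := eqVneq y p1; last exact: ZS1.
    rewrite xp1; have [->|yp2] := eqVneq y p2; last exact: ZS2.
    by rewrite SE (negPf nQ12) (negPf nZ12).
  rewrite yp1; have [->|xp2] := eqVneq x p2; last exact: ZS2.
  by rewrite same_part_sym [sm S _ _]same_part_sym SE (negPf nQ12) (negPf nZ12).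
exfalso; have [s3|s3] := boolP (single Q p3).
  have [_ ZS3] : agree_off p1 Z S /\ agree_off p3 Z S.
    by apply: (star_center vp1 vp3 p13 (moved_pair X1E vp1 (nQv _ v1 s1)) (out _ _ _ X1E p31 vp3)
      (moved_pair X3E vp3 (nQv _ v3 s3)) (out _ _ _ X3E p13 vp1)
      (out _ _ _ X2E p12 vp1) (out _ _ _ X2E p32 vp3)
      (moved_split_agree X1E SE) (moved_split_agree X3E SE) ZX1 ZX3 ZX2).
  by move: Z12; rewrite ZS3 // SE (negPf nQ12).
have Qv3 : sm Q v p3.
  apply: (@star_nonsingle v p3 p1 p2) => //.
  by rewrite /= !inE negb_or p31 p32 p12.
have n12 : nonadj p1 p2 by rewrite /nonadj p12 (same_part_nadj Z12).
have := nonsingle_closed vp3 Qv3 v1 (nQv _ v1 s1) n12.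
by rewrite (negPf (nQv _ v2 s2)).
Qed.

Lemma star_no_far_nbr v p1 p2 p3 X1 X2 X3 Z : uniq [:: p1; p2; p3] ->
  nonadj v p1 -> nonadj v p2 -> nonadj v p3 ->
  sm X1 =2 moved Q [set v; p1] -> sm X2 =2 moved Q [set v; p2] ->
  sm X3 =2 moved Q [set v; p3] ->
  adj Z X1 -> adj Z X2 -> adj Z X3 -> ~~ nonadj Q Z.
Proof.
move=> U v1 v2 v3 X1E X2E X3E ZX1 ZX2 ZX3.
move: (U); rewrite /= !inE negb_or -!andbA => /and4P[p12 p13 p23 _].
have U213 : uniq [:: p2; p1; p3] by rewrite /= !inE negb_or p13 p23 eq_sym p12.
have U132 : uniq [:: p1; p3; p2] by rewrite /= !inE negb_or p13 p12 eq_sym p23.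
have U231 : uniq [:: p2; p3; p1] by rewrite /= !inE negb_or p23 ![_ == p1]eq_sym p12 p13.
have [s1|s1] := boolP (single Q p1); last first.
  have s2 := star_single2 U v1 v2 v3 s1; have s3 := star_single2 U132 v1 v3 v2 s1.
  exact: star_single_nbrs U231 v2 v3 v1 s2 s3 X2E X3E X1E ZX2 ZX3 ZX1.
have [s2|s2] := boolP (single Q p2).
  exact: star_single_nbrs U v1 v2 v3 s1 s2 X1E X2E X3E ZX1 ZX2 ZX3.
have s3 := star_single2 U231 v2 v3 v1 s2.
exact: star_single_nbrs U132 v1 v3 v2 s1 s3 X1E X3E X2E ZX1 ZX3 ZX2.
Qed.

End Full.

(** * The partition into singletons *)

Section Top.
Variables (G : sgraph) (k : nat).
Local Notation UB := (upper_bell k G).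
Local Notation sm := (@same_part G k).
Implicit Types (P Q R X Y Z T : UB) (x y v : G) (e f g : {set G}).
Hypothesis le_k : k + 2 <= #|G|.

Lemma kernel_part (h : G -> G) a c : (forall x, x != a -> x != c -> h x = x) ->
  (forall x y, h x = h y -> ~~ adj x y) -> exists P, forall x y, sm P x y = (h x == h y).
Proof.
move=> hid hadj; apply: (@part_of_rel G k (fun x y => h x == h y) (~: [set a; c])).
- by move=> x y z; split=> // /eqP->.
- by move=> x y /eqP/hadj.
- move=> x y; rewrite !inE !negb_or => /andP[xa xc] /andP[ya yc] /eqP.
  by rewrite !hid.
have := cardsC [set a; c]; rewrite cards2 => cc.
have := leq_b1 (a != c); lia.
Qed.

Lemma top_exists : exists T, forall x y, sm T x y = (x == y).
Proof.
have /card_gt0P[a _] : 0 < #|G| by lia.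
apply: (@kernel_part id a a) => // x y ->; by rewrite adj_irrefl.
Qed.

Definition joins e X := forall x y, sm X x y = (x == y) || (x \in e) && (y \in e).

Definition joins2 e f X := forall x y,
  sm X x y = [|| x == y, (x \in e) && (y \in e) | (x \in f) && (y \in f)].

Lemma joins_inj e X Y : joins e X -> joins e Y -> X = Y.
Proof. by move=> XE YE; apply: same_part_inj => x y; rewrite XE YE. Qed.

Lemma disjoint2 (a b c d : G) : [disjoint [set a; b] & [set c; d]] ->
  [&& a != c, a != d, b != c & b != d].
Proof.
move=> dis; have out z : z \in [set a; b] -> z \in [set c; d] = false by apply: disjointFr dis.
have := out a (set21 _ _); have := out b (set22 _ _).
by rewrite !inE => /negbT; rewrite negb_or => /andP[-> ->] /negbT; rewrite negb_or => /andP[-> ->].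
Qed.

Lemma blocks_exist e f b d a c : b \in e -> (f != set0 -> d \in f) -> [disjoint e & f] ->
  {in e &, forall x y, ~~ adj x y} -> {in f &, forall x y, ~~ adj x y} ->
  e \subset [set a; c; b] -> f \subset [set a; c; d] ->
  exists Z, joins2 e f Z.
Proof.
move=> be df dis eI fI /subsetP es /subsetP fs.
have {}df x : x \in f -> d \in f by move=> xf; apply: df; apply/set0Pn; exists x.
have ef x : x \in e -> x \in f = false by apply: disjointFr dis.
pose h x := if x \in e then b else if x \in f then d else x.
have hE x y : (h x == h y) = [|| x == y, (x \in e) && (y \in e) | (x \in f) && (y \in f)].
  have neq (A : {set G}) u v : u \in A -> v \notin A -> (u == v) = false.
    by move=> uA vA; apply: contraNF vA => /eqP<-.
  rewrite /h; have [xe|xe] := boolP (x \in e); have [ye|ye] := boolP (y \in e).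
  - by rewrite eqxx orbT.
  - rewrite /= (ef x xe) orbF (neq _ _ _ xe ye); case: ifP => [yf|_]; last exact: neq be ye.
    by apply: contraFF (ef b be) => /eqP->; apply: df yf.
  - rewrite /= (ef y ye) andbF orbF [x == y]eq_sym (neq _ _ _ ye xe) eq_sym.
    case: ifP => [xf|_]; last exact: neq be xe.
    by apply: contraFF (ef b be) => /eqP->; apply: df xf.
  rewrite /=; have [xf|xf] := boolP (x \in f); have [yf|yf] := boolP (y \in f).
  - by rewrite eqxx orbT.
  - by rewrite (neq _ _ _ (df x xf) yf) (neq _ _ _ xf yf).
  - by rewrite eq_sym (neq _ _ _ (df y yf) xf) eq_sym (neq _ _ _ yf xf).
  - by rewrite orbF.
have [||P PE] := @kernel_part h a c; last by exists P => x y; rewrite PE hE.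
- move=> x /negPf xa /negPf xc; rewrite /h; case: ifP => [/es|_].
    by rewrite !inE xa xc /= => /eqP.
  by case: ifP => [/fs|//]; rewrite !inE xa xc /= => /eqP.
- move=> x y /eqP; rewrite hE => /or3P[/eqP->|/andP[xe ye]|/andP[xf yf]].
  + by rewrite adj_irrefl.
  + exact: eI.
  + exact: fI.
Qed.

Lemma nonedge_indep e : e \in nonedges G -> {in e &, forall x y, ~~ adj x y}.
Proof.
case/nonedgesP => a [b [/andP[_ nab] ->]] x y; rewrite !inE.
by case/orP=> /eqP-> /orP[]/eqP->; rewrite ?adj_irrefl // adj_sym.
Qed.

Lemma joins2_exists e f : e \in nonedges G -> f \in nonedges G -> [disjoint e & f] ->
  exists Z, joins2 e f Z.
Proof.
move=> en fn dis; have [a [b [_ eE]]] := nonedgesP _ en; have [c [d [_ fE]]] := nonedgesP _ fn.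
apply: (@blocks_exist e f b d a c) => //; try exact: nonedge_indep.
- by rewrite eE set22.
- by rewrite fE set22.
- by apply/subsetP => x; rewrite eE !inE => /orP[]->; rewrite ?orbT.
- by apply/subsetP => x; rewrite fE !inE => /orP[]->; rewrite ?orbT.
Qed.

Lemma joins_exists e : e \in nonedges G -> exists X, joins e X.
Proof.
move=> en; have [a [b [_ eE]]] := nonedgesP _ en.
have [|||||||Z ZE] := @blocks_exist e set0 b b a a.
- by rewrite eE set22.
- by rewrite eqxx.
- by rewrite -setI_eq0 setI0.
- exact: nonedge_indep.
- by move=> x y; rewrite inE.
- by apply/subsetP => x; rewrite eE !inE => /orP[]->; rewrite ?orbT.
- exact: sub0set.
by exists Z => x y; rewrite ZE !inE /= orbF.
Qed.

Lemma triangle_exists a b c : nonadj a b -> nonadj a c -> nonadj b c ->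
  exists Z, joins [set a; b; c] Z.
Proof.
move=> /andP[_ nab] /andP[_ nac] /andP[_ nbc].
have [|||||||Z ZE] := @blocks_exist [set a; b; c] set0 c c a b.
- by rewrite !inE eqxx orbT.
- by rewrite eqxx.
- by rewrite -setI_eq0 setI0.
- move=> u v; rewrite !inE -!orbA => /or3P[]/eqP-> /or3P[]/eqP->; rewrite ?adj_irrefl //;
  by rewrite adj_sym.
- by move=> x y; rewrite inE.
- exact: subxx.
- exact: sub0set.
by exists Z => x y; rewrite ZE !inE /= orbF.
Qed.

Variable T : UB.
Hypothesis TE : forall x y, sm T x y = (x == y).

Lemma top_nbr X : adj T X -> exists2 e, e \in nonedges G & joins e X.
Proof.
case/upper_bell_adjP => TX [v TXv].
have [/existsP[w /andP[Xvw wv]]|nex] := boolP [exists w, sm X v w && (w != v)]; last first.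
  case: TX; apply: same_part_inj => x y; rewrite TE.
  have Xv z : sm X v z = (v == z).
    apply/idP/eqP => [Xvz|->]; last exact: same_part_refl.
    move: nex; rewrite negb_exists => /forallP/(_ z); rewrite Xvz negbK.
    by move/eqP.
  have [->|xv] := eqVneq x v; first by rewrite Xv.
  have [->|yv] := eqVneq y v; first by rewrite same_part_sym Xv eq_sym.
  by rewrite -TXv // TE.
have vw : v != w by rewrite eq_sym.
exists [set v; w]; first by apply: mem_nonedges; rewrite /nonadj vw (same_part_nadj Xvw).
have Xv z : sm X v z = (z == v) || (z == w).
  apply/idP/orP => [Xvz|[]/eqP->//]; last exact: same_part_refl.
  have [?|zv] := eqVneq z v; [by left | right].
  by rewrite eq_sym -TE TXv // (same_part_trans _ Xvz) // same_part_sym.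
have Xw z : sm X w z = (z == v) || (z == w).
  by rewrite -Xv; apply/idP/idP; apply: same_part_trans; rewrite // same_part_sym.
move=> x y; rewrite !inE.
have [->|xv] := eqVneq x v; first by rewrite Xv [v == y]eq_sym; case: (y == v).
have [->|xw] := eqVneq x w; first by rewrite Xw [w == y]eq_sym; case: (y == v); case: (y == w).
have [->|yv] := eqVneq y v; first by rewrite same_part_sym Xv (negPf xv) (negPf xw).
by rewrite -TXv // TE /= orbF.
Qed.

Lemma top_joins_adj e X : e \in nonedges G -> joins e X -> adj T X.
Proof.
case/nonedgesP => a [b [ab ->]] XE; have nab := nonadj_neq ab.
apply: (@adjI G k a a b); last by rewrite TE XE !inE !eqxx orbT (negPf nab).
move=> x y xa ya; rewrite TE XE !inE (negPf xa) (negPf ya) /=.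
by case: eqVneq => //= xy; apply/esym/negP => /andP[/eqP xb /eqP yb]; rewrite xb yb eqxx in xy.
Qed.

Lemma joins_meet_adj v p q X Y : joins [set v; p] X -> joins [set v; q] Y -> agree_off v X Y.
Proof.
move=> XE YE x y xv yv; rewrite XE YE !inE (negPf xv) (negPf yv) /=.
case: eqVneq => //= xy; apply/idP/idP => /andP[/eqP xp /eqP yp];
by rewrite xp yp eqxx in xy.
Qed.

Lemma joins_disjoint e f X Y : e \in nonedges G -> f \in nonedges G -> [disjoint e & f] ->
  joins e X -> joins f Y -> nonadj X Y.
Proof.
case/nonedgesP => a [b [ab ->]] /nonedgesP[c [d [cd ->]]] /disjoint2 dis XE YE.
have /and4P[/negPf ac /negPf ad /negPf bc /negPf bd] := dis.
apply: (@nonadj2 G k a b c d) => //.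
  by rewrite XE YE !inE !eqxx ac ad bc bd orbT (negPf (nonadj_neq ab)).
by rewrite XE YE !inE !eqxx ![c == _]eq_sym ![d == _]eq_sym ac ad bc bd orbT eq_sym (negPf (nonadj_neq cd)).
Qed.

Lemma joins_adj_meet e f X Y : e \in nonedges G -> f \in nonedges G ->
  joins e X -> joins f Y -> adj X Y -> exists2 v, v \in e & v \in f.
Proof.
move=> en fn XE YE XY; have [dis|] := boolP [disjoint e & f].
  by have /andP[_] := joins_disjoint en fn dis XE YE; rewrite XY.
by case/pred0Pn => v /andP[]; exists v.
Qed.

Lemma joins_nonadj_disjoint e f X Y : e \in nonedges G -> f \in nonedges G ->
  joins e X -> joins f Y -> nonadj X Y -> [disjoint e & f].
Proof.
move=> en fn XE YE XY; apply: contraLR XY => /pred0Pn[v /andP[ve vf]].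
have [p _ eE] := nonedge_mem en ve; have [q _ fE] := nonedge_mem fn vf.
rewrite eE in XE; rewrite fE in YE; exact: agree_off_nonadj (joins_meet_adj XE YE).
Qed.

Lemma joins_off_top e x X : e \in nonedges G -> joins e X -> x \in e -> agree_off x X T.
Proof.
move=> en XE xe; have [p _ eE] := nonedge_mem en xe.
move=> y z yx zx; rewrite XE TE eE !inE (negPf yx) (negPf zx) /=.
by case: eqVneq => //= yz; apply/negP => /andP[/eqP yp /eqP zp]; rewrite yp zp eqxx in yz.
Qed.

Lemma joins2_top e f Z : e \in nonedges G -> f \in nonedges G -> [disjoint e & f] ->
  joins2 e f Z -> nonadj T Z.
Proof.
case/nonedgesP => a [b [ab ->]] /nonedgesP[c [d [cd ->]]] /disjoint2 dis ZE.
apply: (@nonadj2 G k a b c d) => //.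
  by rewrite TE ZE !inE !eqxx !orbT (negPf (nonadj_neq ab)).
by rewrite TE ZE !inE !eqxx !orbT (negPf (nonadj_neq cd)).
Qed.

Lemma joins2_adj e f X Z : e \in nonedges G -> f \in nonedges G -> [disjoint e & f] ->
  joins2 e f Z -> joins e X -> adj Z X.
Proof.
move=> en /nonedgesP[c [d [cd ->]]] dis ZE XE; have ncd := nonadj_neq cd.
have ce : c \in e = false by rewrite (disjointFl dis) // set21.
apply: (@adjI G k c c d); last by rewrite ZE XE !inE !eqxx !orbT ce (negPf ncd).
move=> x y xc yc; rewrite ZE XE !inE (negPf xc) (negPf yc) /=.
case: eqVneq => //= xy; case: (_ && (y \in e)) => //=.
by apply/negP => /andP[/eqP xd /eqP yd]; rewrite xd yd eqxx in xy.
Qed.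

Lemma joins2C e f Z : joins2 e f Z -> joins2 f e Z.
Proof. by move=> ZE x y; rewrite ZE; congr (_ || _); rewrite orbC. Qed.

Lemma joins2_uniq e f X Y Z : e \in nonedges G -> f \in nonedges G -> [disjoint e & f] ->
  joins e X -> joins f Y -> nonadj T Z -> adj Z X -> adj Z Y -> joins2 e f Z.
Proof.
move=> en fn dis XE YE TZ /adj_agree[x ZX] /adj_agree[y ZY].
have out e' x' X' : e' \in nonedges G -> joins e' X' -> agree_off x' Z X' -> x' \notin e'.
  move=> en' XE' ZX'; apply: contraL TZ => xe; apply: (@agree_off_nonadj _ _ x').
  apply: agree_off_sym; apply: (agree_off_trans ZX'); exact: joins_off_top en' XE' xe.
have xe := out _ _ _ en XE ZX; have yf := out _ _ _ fn YE ZY.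
have ef z : z \in e -> z \in f = false by apply: disjointFr dis.
have in_ne (A : {set G}) u v : u \in A -> v \notin A -> u != v.
  by move=> uA; apply: contraNneq => <-.
have Ze p q : p \in e -> q \in e -> sm Z p q.
  by move=> pe qe; rewrite ZX ?XE ?pe ?qe ?orbT //; apply: in_ne xe.
have Zf p q : p \in f -> q \in f -> sm Z p q.
  by move=> pe qe; rewrite ZY ?YE ?pe ?qe ?orbT //; apply: in_ne yf.
have ye : y \in e.
  have [a [b [ab eE]]] := nonedgesP _ en; apply: contraT => ye.
  have [ae be] : a \in e /\ b \in e by rewrite eE set21 set22.
  have := Ze _ _ ae be; rewrite ZY ?(in_ne _ _ _ _ ye) // YE (ef a) // orbF.
  by rewrite (negPf (nonadj_neq ab)).
have xf : x \in f.
  have [a [b [ab fE]]] := nonedgesP _ fn; apply: contraT => xf.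
  have [af bf] : a \in f /\ b \in f by rewrite fE set21 set22.
  have := Zf _ _ af bf; rewrite ZX ?(in_ne _ _ _ _ xf) // XE (disjointFl dis af) orbF.
  by rewrite (negPf (nonadj_neq ab)).
have [y' yy' eE] := nonedge_mem en ye; have [x' xx' fE] := nonedge_mem fn xf.
have y'e : y' \in e by rewrite eE set22.
have xy : x != y by apply: in_ne xf yf.
have nZxy : ~~ sm Z x y.
  apply/negP => Zxy; have := same_part_trans Zxy (Ze _ _ ye y'e).
  have y'y : y' != y by rewrite eq_sym nonadj_neq.
  by rewrite ZY // YE (ef y') // andbF orbF => /eqP xy'; rewrite -xy' (negPf xe) in y'e.
have one p q : p \in [set x; x'] -> q \in [set x; x'] -> p != x -> q != x -> p = q.
  by rewrite !inE => /orP[]/eqP-> /orP[]/eqP->; rewrite ?eqxx.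
have one' p q : p \in [set y; y'] -> q \in [set y; y'] -> p != y -> q != y -> p = q.
  by rewrite !inE => /orP[]/eqP-> /orP[]/eqP->; rewrite ?eqxx.
have offx p q : p != x -> q != x -> sm Z p q = [|| p == q, (p \in e) && (q \in e) | (p \in f) && (q \in f)].
  move=> px qx; rewrite ZX // XE; case: eqVneq => //= pq; case: (_ && (q \in e)) => //=.
  apply/esym/negP => /andP[pf qf]; rewrite fE in pf qf.
  by rewrite (one p q) ?eqxx in pq.
have offy p q : p != y -> q != y -> sm Z p q = [|| p == q, (p \in e) && (q \in e) | (p \in f) && (q \in f)].
  move=> px qx; rewrite ZY // YE; case: eqVneq => //= pq; rewrite orbC; case: (_ && (q \in f)) => //=.
  apply/esym/negP => /andP[pf qf]; rewrite eE in pf qf.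
  by rewrite (one' p q) ?eqxx in pq.
have Zxy : sm Z x y = [|| x == y, (x \in e) && (y \in e) | (x \in f) && (y \in f)].
  by rewrite (negPf nZxy) (negPf xy) (negPf xe) (negPf yf) andbF.
move=> p q.
have [px|px] := eqVneq p x; last have [qx|qx] := eqVneq q x; last exact: offx.
  have [qy|qy] := eqVneq q y; last by apply: offy; rewrite ?px.
  by rewrite px qy.
have [py|py] := eqVneq p y; last by apply: offy; rewrite ?qx.
by rewrite py qx same_part_sym Zxy eq_sym ![(x \in _) && _]andbC.
Qed.

Lemma top_star v p1 p2 p3 X1 X2 X3 Z : uniq [:: p1; p2; p3] ->
  v != p1 -> v != p2 -> v != p3 ->
  joins [set v; p1] X1 -> joins [set v; p2] X2 -> joins [set v; p3] X3 ->
  adj Z X1 -> adj Z X2 -> adj Z X3 -> ~~ nonadj T Z.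
Proof.
move=> U vp1 vp2 vp3 X1E X2E X3E.
move=> /adj_agree[x1 ZX1] /adj_agree[x2 ZX2] /adj_agree[x3 ZX3].
move: (U); rewrite /= !inE negb_or -!andbA => /and4P[p12 p13 p23 _].
have offT w p X : joins [set w; p] X -> agree_off w X T.
  move=> XE y z yx zx; rewrite XE TE !inE (negPf yx) (negPf zx) /=.
  by case: eqVneq => //= yz; apply/negP => /andP[/eqP yp /eqP zp]; rewrite yp zp eqxx in yz.
have offT' w p X : joins [set w; p] X -> agree_off p X T by rewrite setUC; apply: offT.
have final x X : agree_off x Z X -> agree_off x X T -> ~~ nonadj T Z.
  by move=> ZX XQ; apply: (@agree_off_nonadj _ _ x); apply/agree_off_sym/(agree_off_trans ZX).
have [xv|x1v] := eqVneq x1 v; first by apply: (final _ _ ZX1); rewrite xv; apply: offT X1E.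
have [xv|x2v] := eqVneq x2 v; first by apply: (final _ _ ZX2); rewrite xv; apply: offT X2E.
have [xv|x3v] := eqVneq x3 v; first by apply: (final _ _ ZX3); rewrite xv; apply: offT X3E.
have inX X p : joins [set v; p] X -> sm X v p by move=> XE; rewrite XE !inE !eqxx !orbT.
have outX X p q : joins [set v; p] X -> v != q -> p != q -> ~~ sm X v q.
  by move=> XE vq pq; rewrite XE !inE ![q == _]eq_sym (negPf vq) (negPf pq) andbF.
have p21 : p2 != p1 by rewrite eq_sym.
have p31 : p3 != p1 by rewrite eq_sym.
have p32 : p3 != p2 by rewrite eq_sym.
have [ZT _] : agree_off p1 Z T /\ agree_off p2 Z T.
  by apply: (star_center vp1 vp2 p12 (inX _ _ X1E) (outX _ _ _ X1E vp2 p12)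
    (inX _ _ X2E) (outX _ _ _ X2E vp1 p21) (outX _ _ _ X3E vp1 p31) (outX _ _ _ X3E vp2 p32)
    (offT' _ _ _ X1E) (offT' _ _ _ X2E) ZX1 ZX2 ZX3).
exact/(@agree_off_nonadj _ _ p1)/agree_off_sym.
Qed.

Lemma top_line_like : line_like T.
Proof.
split.
- move=> X Y /top_nbr[e en XE] /top_nbr[f fn YE] XY.
  have dis := joins_nonadj_disjoint en fn XE YE XY.
  have [Z ZE] := joins2_exists en fn dis; exists Z; split.
  + exact: joins2_top ZE.
  + exact: joins2_adj ZE XE.
  + by apply: (joins2_adj fn en _ (joins2C ZE) YE); rewrite disjoint_sym.
- move=> X Y Z Z' /top_nbr[e en XE] /top_nbr[f fn YE] XY TZ ZX ZY TZ' ZX' ZY'.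
  have dis := joins_nonadj_disjoint en fn XE YE XY.
  have ZE := joins2_uniq en fn dis XE YE TZ ZX ZY.
  have ZE' := joins2_uniq en fn dis XE YE TZ' ZX' ZY'.
  by apply: same_part_inj => x y; rewrite ZE ZE'.
- move=> X Y Z W /top_nbr[e en XE] /top_nbr[f fn YE] XY TZ ZX ZY /top_nbr[g gn WE].
  have dis := joins_nonadj_disjoint en fn XE YE XY.
  have ZE := joins2_uniq en fn dis XE YE TZ ZX ZY.
  move=> /adj_agree[x ZW].
  have join e' : e' \in nonedges G -> x \notin e' -> {in e' &, forall p q, sm Z p q} -> g = e'.
    move=> /nonedgesP[a [b [ab ->]]]; rewrite !inE negb_or ![x == _]eq_sym => /andP[ax bx] Zj.
    have := Zj a b (set21 _ _) (set22 _ _); rewrite ZW // WE (negPf (nonadj_neq ab)) /=.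
    by case/andP => ag bg; apply: nonedge_eq => //; apply: nonadj_neq.
  have [xe|xe] := boolP (x \in e); [right | left].
    have ge : g = f.
      by apply: join => [||p q pf qf]; rewrite ?(disjointFr dis) // ZE pf qf !orbT.
    by apply: joins_inj YE; rewrite -ge.
  have ge : g = e by apply: join => // p q pe qe; rewrite ZE pe qe !orbT.
  by apply: joins_inj XE; rewrite -ge.
- move=> X Y W Z U /top_nbr[e en XE] /top_nbr[f fn YE] /top_nbr[g gn WE] XY XW YW TZ ZX ZY ZW.
  move=> /top_nbr[u un UE] UX [UY UW].
  have duf := joins_nonadj_disjoint un fn UE YE UY.
  have dug := joins_nonadj_disjoint un gn UE WE UW.
  have [a au ae] := joins_adj_meet un en UE XE UX.
  have [b ab eE] := nonedge_mem en ae.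
  have [af ag] : a \in f = false /\ a \in g = false by rewrite (disjointFr duf) ?(disjointFr dug).
  have bf : b \in f.
    have [z ze zf] := joins_adj_meet en fn XE YE XY.
    by move: ze; rewrite eE !inE => /orP[]/eqP zE; [rewrite zE af in zf | rewrite -zE].
  have bg : b \in g.
    have [z ze zg] := joins_adj_meet en gn XE WE XW.
    by move: ze; rewrite eE !inE => /orP[]/eqP zE; [rewrite zE ag in zg | rewrite -zE].
  have [c bc fE] := nonedge_mem fn bf; have [d bd gE] := nonedge_mem gn bg.
  have ba : nonadj b a by rewrite nonadj_sym.
  suff /negP : ~~ nonadj T Z by apply.
  rewrite eE setUC in XE; rewrite fE in YE; rewrite gE in WE.
  apply: (top_star _ _ _ _ XE YE WE ZX ZY ZW); rewrite ?nonadj_neq //.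
  rewrite /= !inE negb_or -!andbA; apply/and4P; split=> //.
  + by apply: contraFneq af => ->; rewrite fE set22.
  + by apply: contraFneq ag => ->; rewrite gE set22.
  + apply/eqP => cd; have eqYW : Y = W by apply: joins_inj YE _; rewrite cd.
    by move: YW; rewrite eqYW adj_irrefl.
- move=> X Y U Z1 Z2 /top_nbr[e en XE] /top_nbr[f fn YE] /top_nbr[g gn UE] XY UX UY.
  move=> TZ1 Z1X Z1U TZ2 Z2Y Z2U; apply/negP.
  have dge := joins_nonadj_disjoint gn en UE XE UX.
  have dgf := joins_nonadj_disjoint gn fn UE YE UY.
  have Z1E := joins2_uniq gn en dge UE XE TZ1 Z1U Z1X.
  have Z2E := joins2_uniq gn fn dgf UE YE TZ2 Z2U Z2Y.
  have [b be bf] := joins_adj_meet en fn XE YE XY.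
  apply: (@agree_off_nonadj _ _ b) => x y xb yb; rewrite Z1E Z2E.
  have XYb : agree_off b X Y.
    have [p _ eE] := nonedge_mem en be; have [q _ fE] := nonedge_mem fn bf.
    by apply: (@joins_meet_adj b p q); [rewrite -eE | rewrite -fE].
  have := XYb x y xb yb; rewrite XE YE.
  by case: (x == y) => //= ->.
Qed.

End Top.

(** * Whitney's theorem with known triangles *)

Definition triangle (G : sgraph) (t : {set G} * {set G} * {set G}) : bool :=
  let: (e, f, g) := t in
  [&& [&& e \in nonedges G, f \in nonedges G & g \in nonedges G],
      [&& e != f, e != g & f != g],
      [&& ~~ [disjoint e & f], ~~ [disjoint e & g] & ~~ [disjoint f & g]]
    & e :&: f :&: g == set0].

Lemma triangleP (G : sgraph) (e f g : {set G}) : triangle (e, f, g) ->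
  exists a b c, [/\ nonadj a b, nonadj a c, nonadj b c &
    [/\ e = [set a; b], f = [set a; c] & g = [set b; c]]].
Proof.
case/and4P => /and3P[en fn gn] /and3P[ef eg fg] /and3P[/meetP[a ae af] meg mfg] /eqP efg.
have ag : a \notin g.
  by apply/negP => ag; have := in_set0 a; rewrite -efg !inE ae af ag.
have [b ab eE] := nonedge_mem en ae; have [c ac fE] := nonedge_mem fn af.
have bg : b \in g.
  case/meetP: meg => z; rewrite eE !inE => /orP[]/eqP-> // ag'.
  by rewrite ag' in ag.
have cg : c \in g.
  case/meetP: mfg => z; rewrite fE !inE => /orP[]/eqP-> // ag'.
  by rewrite ag' in ag.
have bc : b != c by apply: contraNneq ef => bc; rewrite eE fE bc.
have gE := nonedge_eq gn bg cg bc.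
exists a, b, c; split=> //; apply: nonedges_nonadj bc; by rewrite -gE.
Qed.

Lemma triangleI (G : sgraph) (a b c : G) : nonadj a b -> nonadj a c -> nonadj b c ->
  triangle ([set a; b], [set a; c], [set b; c]).
Proof.
move=> ab ac bc; have nab := nonadj_neq ab; have nac := nonadj_neq ac.
have nbc := nonadj_neq bc.
have meet (A B : {set G}) z : z \in A -> z \in B -> ~~ [disjoint A & B].
  by move=> zA zB; apply/meetP; exists z.
rewrite /triangle !mem_nonedges //=; apply/and3P; split.
- apply/and3P; split; apply/eqP.
  + move/setP/(_ b); rewrite !inE eqxx orbT [b == a]eq_sym (negPf nab) (negPf nbc); by [].
  + move/setP/(_ a); rewrite !inE eqxx (negPf nab) (negPf nac); by [].
  + move/setP/(_ a); rewrite !inE eqxx (negPf nab) (negPf nac); by [].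
- apply/and3P; split.
  + by apply: (@meet _ _ a); rewrite set21.
  + by apply: (@meet _ _ b); rewrite ?set21 ?set22.
  + by apply: (@meet _ _ c); rewrite set22.
- apply/eqP/setP => z; rewrite !inE.
  have [->|za] := eqVneq z a; first by rewrite (negPf nab) (negPf nac).
  by have [->|zb] := eqVneq z b; rewrite //= (negPf nbc).
Qed.

Record line_iso (G1 G2 : sgraph) (s : {set G1} -> {set G2}) : Prop := LineIso {
  li_in : forall e, e \in nonedges G1 -> s e \in nonedges G2;
  li_inj : {in nonedges G1 &, injective s};
  li_onto : forall f, f \in nonedges G2 -> exists2 e, e \in nonedges G1 & s e = f;
  li_meet : {in nonedges G1 &, forall e f, e != f ->
    [disjoint s e & s f] = [disjoint e & f]};
  li_triangle : {in nonedges G1 & &, forall e f g,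
    triangle (s e, s f, s g) = triangle (e, f, g)}
}.

Section Whitney.
Variables (G1 G2 : sgraph) (s : {set G1} -> {set G2}).
Hypothesis s_iso : line_iso s.
Hypothesis no_isolated : forall v : G1, exists w, nonadj v w.

Lemma nonedge_neq (v w w' : G1) : w != w' -> [set v; w] != [set v; w'].
Proof.
move=> ww'; apply/eqP => vw.
have := set22 v w; rewrite vw !inE (negPf ww') orbF => /eqP wv.
by have := set22 v w'; rewrite -vw -wv !inE orbb eq_sym (negPf ww').
Qed.

Lemma star_image (v : G1) : exists x : G2, forall w, nonadj v w -> x \in s [set v; w].
Proof.
have [w vw] := no_isolated v; have vwn := mem_nonedges vw.
have [/existsP[w' /andP[vw' ww']]|nex] := boolP [exists w', nonadj v w' && (w != w')]; last first.
  have [x [y [_ sE]]] := nonedgesP _ (li_in s_iso vwn).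
  exists x => w' vw'; move: nex; rewrite negb_exists => /forallP/(_ w').
  by rewrite vw' negbK => /eqP<-; rewrite sE set21.
have vwn' := mem_nonedges vw'; have ne := nonedge_neq v ww'.
have meet w1 w2 : nonadj v w1 -> nonadj v w2 -> w1 != w2 ->
    ~~ [disjoint s [set v; w1] & s [set v; w2]].
  move=> v1 v2 n12; rewrite (li_meet s_iso) ?mem_nonedges ?nonedge_neq //.
  by apply/meetP; exists v; rewrite set21.
have /meetP[x xw xw'] := meet _ _ vw vw' ww'.
exists x => u vu; have [<-//|wu] := eqVneq w u; have [<-//|wu'] := eqVneq w' u.
have vun := mem_nonedges vu.
have sn := li_in s_iso vwn; have sn' := li_in s_iso vwn'; have snu := li_in s_iso vun.
have sne w1 w2 : nonadj v w1 -> nonadj v w2 -> w1 != w2 -> s [set v; w1] != s [set v; w2].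
  move=> v1 v2 n12; apply: contraNneq (nonedge_neq v n12) => eqs.
  by rewrite (li_inj s_iso _ _ eqs) ?mem_nonedges.
have : ~~ triangle (s [set v; w], s [set v; w'], s [set v; u]).
  rewrite (li_triangle s_iso) //; apply/negP; rewrite /triangle => /and4P[_ _ _ /eqP].
  by move/setP/(_ v); rewrite !inE eqxx.
rewrite /triangle sn sn' snu !sne // !meet //= => /set0Pn[y].
rewrite !inE -andbA => /and3P[yw yw' yu].
have [<-//|yx] := eqVneq y x.
have := sne _ _ vw vw' ww'.
by rewrite (nonedge_eq sn yw xw yx) (nonedge_eq sn' yw' xw' yx) eqxx.
Qed.

Definition leaf (v : G1) : bool :=
  [forall w, forall w', nonadj v w ==> nonadj v w' ==> (w == w')].

Lemma leafP (v : G1) : reflect (forall w w', nonadj v w -> nonadj v w' -> w = w') (leaf v).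
Proof.
apply: (iffP forallP) => [lv w w' vw vw'|lv w].
  by have /forallP/(_ w') := lv w; rewrite vw vw' => /eqP.
by apply/forallP => w'; apply/implyP => vw; apply/implyP => vw'; apply/eqP/lv.
Qed.

Lemma not_leaf (v w : G1) : ~~ leaf v -> exists2 a, nonadj v a & a != w.
Proof.
move=> lv; have [/existsP[a /andP[va aw]]|nex] := boolP [exists a, nonadj v a && (a != w)].
  by exists a.
case/leafP: lv => b c vb vc; move: nex; rewrite negb_exists => /forallP nex.
have := nex b; have := nex c; rewrite vb vc /= !negbK.
by move=> /eqP-> /eqP->.
Qed.

(* A vertex lying on two non-edges has a forced image, by star_image. For a leaf
   it is the other end of the image edge; for an isolated edge the enumeration
   order decides which end counts as the leaf. *)
Lemma whitney : exists h : G1 -> G2,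
  forall v w, nonadj v w -> s [set v; w] = [set h v; h w].
Proof.
have [h0 h0P] := fin_all_exists star_image.
pose flip v := leaf v &&
  [forall w, nonadj v w ==> (~~ leaf w || (enum_rank w < enum_rank v))].
have [v|h hP] := @fin_all_exists _ _ (fun v y => if flip v then
    forall w, nonadj v w -> y \in s [set v; w] /\ y != h0 w else y = h0 v).
  case fv: (flip v); last by exists (h0 v).
  have /andP[/leafP lv _] := fv.
  have [w vw] := no_isolated v.
  have /nonedgesP[x [y [xy sE]]] := li_in s_iso (mem_nonedges vw).
  have nxy := nonadj_neq xy.
  have [xh|xh] := eqVneq x (h0 w); [exists y | exists x] => u vu;
    by rewrite (lv _ _ vu vw) sE !inE eqxx ?orbT //; split=> //; rewrite -xh eq_sym.
have mem v w : nonadj v w -> h v \in s [set v; w].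
  by move=> vw; have := hP v; case: (flip v) => [/(_ w vw)[]//|->]; apply: h0P.
have rankF v w : nonadj v w -> flip v -> leaf w -> enum_rank w < enum_rank v.
  by move=> vw /andP[_ /forallP/(_ w)]; rewrite vw /= => /orP[/negP|].
have nflip v w : nonadj v w -> leaf v -> ~~ flip v -> leaf w && (enum_rank v <= enum_rank w).
  move=> vw lv; rewrite /flip lv negb_forall => /existsP[u].
  rewrite negb_imply negb_or negbK -leqNgt => /andP[vu].
  by move/leafP: lv => /(_ _ _ vu vw)->.
exists h => v w vw; have wv : nonadj w v by rewrite nonadj_sym.
have swv : s [set w; v] = s [set v; w] by rewrite setUC.
have sn := li_in s_iso (mem_nonedges vw); have nvw := nonadj_neq vw.
apply: nonedge_eq => //; [exact: mem | by rewrite -swv; apply: mem |].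
have hv := hP v; have hw := hP w.
have [fv|fv] := boolP (flip v); have [fw|fw] := boolP (flip w).
- have := rankF v w vw fv; have := rankF w v wv fw.
  case/andP: fv => -> _; case/andP: fw => -> _ => /(_ isT) ? /(_ isT) ?; lia.
- by rewrite fv in hv; rewrite (negPf fw) in hw; rewrite hw; case: (hv w vw).
- by rewrite fw in hw; rewrite (negPf fv) in hv; rewrite hv eq_sym; case: (hw v wv).
rewrite (negPf fv) in hv; rewrite (negPf fw) in hw.
have nlv : ~~ leaf v.
  apply/negP => lv; have /andP[lw rvw] := nflip _ _ vw lv fv.
  have /andP[_ rwv] := nflip _ _ wv lw fw.
  have /eqP : enum_rank v = enum_rank w by apply: val_inj; apply/eqP; rewrite eqn_leq rvw rwv.
  by rewrite (inj_eq enum_rank_inj) (negPf nvw).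
have nlw : ~~ leaf w.
  by apply: contraNN nlv => lw; have /andP[] := nflip _ _ wv lw fw.
have [a va aw] := not_leaf w nlv; have [b wb bv] := not_leaf v nlw.
rewrite hv hw; apply/eqP => h0vw.
have xva := h0P v a va; have xwb := h0P w b wb; have xvw := h0P v w vw.
have ne : [set v; a] != [set w; b].
  by apply: contraNneq bv => vawb; have := set21 v a; rewrite vawb !inE (negPf nvw) eq_sym.
have : ~~ [disjoint [set v; a] & [set w; b]].
  rewrite -(li_meet s_iso) ?mem_nonedges //; apply/meetP; exists (h0 v) => //.
  by rewrite h0vw.
case/meetP => z; rewrite !inE => /orP[]/eqP->.
  by rewrite (negPf nvw) eq_sym (negPf bv).
rewrite (negPf aw) => /= /eqP ab; rewrite -ab in wb xwb.
have := triangleI vw va wb; rewrite -(li_triangle s_iso) ?mem_nonedges //.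
case/and4P => _ _ _ /eqP/setP/(_ (h0 v)); by rewrite !inE xvw xva h0vw xwb.
Qed.

End Whitney.

(** * Reconstruction *)

Section Transfer.
Variables (G1 G2 : sgraph) (k1 k2 : nat).
Hypothesis le_k1 : k1 + 2 <= #|G1|.
Variable f : upper_bell k1 G1 -> upper_bell k2 G2.
Hypothesis bij_f : bijective f.
Hypothesis adj_f : forall X Y, adj (f X) (f Y) = adj X Y.

Lemma nonedge_transfer : exists s : {set G1} -> {set G2},
  [/\ forall e, e \in nonedges G1 -> s e \in nonedges G2,
      {in nonedges G1 &, injective s} &
      #|nonedges G2| <= #|nonedges G1| ->
      [/\ forall g, g \in nonedges G2 -> exists2 e, e \in nonedges G1 & s e = g,
          {in nonedges G1 &, forall e g, e != g -> [disjoint s e & s g] = [disjoint e & g]} &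
          forall a b c, nonadj a b -> nonadj a c -> nonadj b c ->
          triangle (s [set a; b], s [set a; c], s [set b; c])]].
Proof.
have [T TE] := top_exists le_k1; have llT := top_line_like le_k1 TE.
have llQ := line_like_iso bij_f adj_f llT; set Q := f T in llQ.
have nonadj_f X Y : nonadj (f X) (f Y) = nonadj X Y.
  by rewrite /nonadj adj_f (inj_eq (bij_inj bij_f)).
have [e|s sP] := @fin_all_exists _ _ (fun e g => e \in nonedges G1 ->
    exists X, [/\ adj T X, joins e X & codes Q (f X) g]).
  have [en|_] := boolP (e \in nonedges G1); last by exists set0.
  have [X XE] := joins_exists le_k1 en.
  have TX := top_joins_adj TE en XE.
  have [|g gP] := @nbr_codes _ _ Q llQ (f X); first by rewrite adj_f.
  by exists g => _; exists X.
have s_in e : e \in nonedges G1 -> s e \in nonedges G2.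
  by case/sP => X [_ _ /codes_nonedge].
have s_inj : {in nonedges G1 &, injective s}.
  move=> e e' en en' eqs; have [X [_ XE Xc]] := sP e en; have [X' [_ XE' Xc']] := sP e' en'.
  have /(bij_inj bij_f) XX' : f X = f X' by apply: codes_inj Xc _; rewrite eqs.
  have [a [b [ab eE]]] := nonedgesP _ en.
  have := XE' a b; rewrite -XX' XE eE set21 set22 orbT (negPf (nonadj_neq ab)) /=.
  by case/esym/andP => ae be; rewrite (nonedge_eq en' ae be) // nonadj_neq.
exists s; split=> // le21.
have s_onto g : g \in nonedges G2 -> exists2 e, e \in nonedges G1 & s e = g.
  have /eqP <- : s @: nonedges G1 == nonedges G2.
    rewrite eqEcard card_in_imset // le21 andbT.
    by apply/subsetP => _ /imsetP[e en ->]; apply: s_in.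
  by case/imsetP => e en ->; exists e.
have fullQ : full Q.
  move=> x y /mem_nonedges/s_onto[e /sP[X [TX _ Xc]] <-].
  by exists (f X); rewrite adj_f.
have s_meet : {in nonedges G1 &, forall e g, e != g -> [disjoint s e & s g] = [disjoint e & g]}.
  move=> e g en gn eg; have [X [_ XE Xc]] := sP e en; have [Y [_ YE Yc]] := sP g gn.
  have [_ [_ [_ _ _ fXE]]] := Xc; have [_ [_ [_ _ _ fYE]]] := Yc.
  apply/idP/idP => [dis|].
    apply: (@joins_nonadj_disjoint _ _ _ _ X Y) => //; rewrite -nonadj_f.
    exact: (disjoint_nonadj llQ fullQ (s_in _ en) (s_in _ gn) dis fXE fYE).
  apply: contraLR => /meetP[v ve vg].
  have [p vp eE] := nonedge_mem (s_in _ en) ve; have [q vq gE] := nonedge_mem (s_in _ gn) vg.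
  apply/negP => dis; have := joins_disjoint en gn dis XE YE.
  rewrite -nonadj_f; apply/negP; apply: (@agree_off_nonadj _ _ v).
  rewrite eE in fXE; rewrite gE in fYE; apply: (meet_agree llQ fullQ vp vq _ fXE fYE).
  by apply: contraNneq eg => pq; apply/eqP/s_inj; rewrite // eE gE pq.
split=> // a b c ab ac bc.
have nab := nonadj_neq ab; have nac := nonadj_neq ac; have nbc := nonadj_neq bc.
have [Z ZE] := triangle_exists le_k1 ab ac bc.
have TZ : nonadj T Z.
  by apply: (@nonadj3 _ _ a b c); rewrite ?TE ?ZE ?inE ?eqxx ?orbT ?nab ?nac ?nbc
    ?(negPf nab) ?(negPf nac) ?(negPf nbc).
have ZX x y z X : [set a; b; c] = [set x; y; z] -> x != z -> y != z ->
    joins [set x; y] X -> adj Z X.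
  move=> SE xz yz XE; apply: (@adjI _ _ z x z).
    by move=> p q pz qz; rewrite ZE XE SE !inE (negPf pz) (negPf qz) !orbF.
  rewrite ZE XE SE !inE !eqxx !orbT /= ![z == _]eq_sym.
  by rewrite (negPf xz) (negPf yz).
have := triangleI ab ac bc.
move: (mem_nonedges ab) (mem_nonedges ac) (mem_nonedges bc).
set e := [set a; b]; set g := [set a; c]; set h := [set b; c] => en gn hn.
case/and4P => _ /and3P[neg neh ngh] /and3P[meg meh mgh] _.
have s_neq e1 e2 : e1 \in nonedges G1 -> e2 \in nonedges G1 -> e1 != e2 -> s e1 != s e2.
  by move=> e1n e2n; apply: contraNneq => /s_inj->.
have [X [_ XE [_ [_ [_ _ _ XM]]]]] := sP e en.
have [Y [_ YE [_ [_ [_ _ _ YM]]]]] := sP g gn.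
have [W [_ WE [_ [_ [_ _ _ WM]]]]] := sP h hn.
rewrite /triangle !s_in // !s_neq // !s_meet // meg meh mgh /=.
apply/set0Pn => -[v]; rewrite !inE -andbA => /and3P[ve vg vh].
have [p1 v1 eE] := nonedge_mem (s_in _ en) ve.
have [p2 v2 gE] := nonedge_mem (s_in _ gn) vg.
have [p3 v3 hE] := nonedge_mem (s_in _ hn) vh.
rewrite eE in XM; rewrite gE in YM; rewrite hE in WM.
have sneg := s_neq _ _ en gn neg; have sneh := s_neq _ _ en hn neh.
have sngh := s_neq _ _ gn hn ngh.
have U : uniq [:: p1; p2; p3].
  rewrite /= !inE negb_or -!andbA; apply/and4P; split=> //.
  - by apply: contraNneq sneg => p12; rewrite eE gE p12.
  - by apply: contraNneq sneh => p13; rewrite eE hE p13.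
  - by apply: contraNneq sngh => p23; rewrite gE hE p23.
have : ~~ nonadj Q (f Z).
  apply: (star_no_far_nbr llQ fullQ U v1 v2 v3 XM YM WM); rewrite adj_f.
  - exact: (ZX a b c).
  - apply: (ZX a c b); rewrite // 1?eq_sym //.
    by apply/setP => z; rewrite !inE -!orbA [(z == b) || _]orbC.
  - apply: (ZX b c a); rewrite // 1?eq_sym //.
    by apply/setP => z; rewrite !inE -!orbA orbC -!orbA.
by rewrite nonadj_f TZ.
Qed.

End Transfer.

Lemma isomorphic_sym (G H : sgraph) : isomorphic G H -> isomorphic H G.
Proof.
case=> f [g fK gK] adj_f; exists g; first by exists f.
by move=> x y; rewrite -adj_f !gK.
Qed.

Lemma card_nonedges_iso (G1 G2 : sgraph) (k1 k2 : nat) : k1 + 2 <= #|G1| ->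
  isomorphic (upper_bell k1 G1) (upper_bell k2 G2) ->
  #|nonedges G1| <= #|nonedges G2|.
Proof.
move=> le_k1 [f bij_f adj_f]; have [s [s_in s_inj _]] := nonedge_transfer le_k1 bij_f adj_f.
rewrite -(card_in_imset s_inj); apply/subset_leq_card/subsetP => _ /imsetP[e en ->].
exact: s_in.
Qed.

Definition map3 (T1 T2 : Type) (s : T1 -> T2) (t : T1 * T1 * T1) : T2 * T2 * T2 :=
  (s t.1.1, s t.1.2, s t.2).

Lemma triangle_nonedges (G : sgraph) (t : {set G} * {set G} * {set G}) : triangle t ->
  [/\ t.1.1 \in nonedges G, t.1.2 \in nonedges G & t.2 \in nonedges G].
Proof. by case: t => -[e f] g /and4P[/and3P[]]. Qed.

Lemma map3_inj (G1 G2 : sgraph) (s : {set G1} -> {set G2}) :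
  {in nonedges G1 &, injective s} ->
  forall t t', triangle t ->
  [/\ t'.1.1 \in nonedges G1, t'.1.2 \in nonedges G1 & t'.2 \in nonedges G1] ->
  map3 s t = map3 s t' -> t = t'.
Proof.
move=> s_inj [[e f] g] [[e' f'] g'] /triangle_nonedges[/= en fn gn] [/= en' fn' gn'].
by case=> /s_inj-> // /s_inj-> // /s_inj->.
Qed.

Lemma line_iso_exists (G1 G2 : sgraph) (k1 k2 : nat) :
  k1 + 2 <= #|G1| -> k2 + 2 <= #|G2| ->
  isomorphic (upper_bell k1 G1) (upper_bell k2 G2) ->
  exists s : {set G1} -> {set G2}, line_iso s.
Proof.
move=> le_k1 le_k2 iso12; have iso21 := isomorphic_sym iso12.
have le12 := card_nonedges_iso le_k1 iso12; have le21 := card_nonedges_iso le_k2 iso21.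
have [f bij_f adj_f] := iso12; have [g bij_g adj_g] := iso21.
have [s [s_in s_inj /(_ le21)[s_onto s_meet s_tri]]] := nonedge_transfer le_k1 bij_f adj_f.
have [r [_ r_inj /(_ le12)[_ _ r_tri]]] := nonedge_transfer le_k2 bij_g adj_g.
have tri_map (K1 K2 : sgraph) (q : {set K1} -> {set K2}) :
    {in nonedges K1 &, injective q} ->
    (forall a b c, nonadj a b -> nonadj a c -> nonadj b c ->
       triangle (q [set a; b], q [set a; c], q [set b; c])) ->
    map3 q @: [set t | triangle t] \subset [set t | triangle t] /\
    #|map3 q @: [set t | triangle t]| = #|[set t | @triangle K1 t]|.
  move=> q_inj q_tri; split; last first.
    apply: card_in_imset => t t'; rewrite !inE => tt tt'.
    by apply: map3_inj => //; apply: triangle_nonedges.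
  apply/subsetP => _ /imsetP[[[x y] z] + ->]; rewrite !inE.
  by case/triangleP => a [b [c [ab ac bc [-> -> ->]]]]; apply: q_tri.
have [s_sub s_card] := tri_map _ _ _ s_inj s_tri.
have [r_sub r_card] := tri_map _ _ _ r_inj r_tri.
have sE : map3 s @: [set t | triangle t] = [set t | triangle t].
  by apply/eqP; rewrite eqEcard s_sub s_card -r_card subset_leq_card.
exists s; split=> // x y z xn yn zn; apply/idP/idP => [stri|/triangleP].
  have : (s x, s y, s z) \in map3 s @: [set t | triangle t] by rewrite sE inE.
  case/imsetP => t; rewrite inE => tt eqt.
  by rewrite -(@map3_inj _ _ s s_inj t (x, y, z) tt).
by case=> a [b [c [ab ac bc [-> -> ->]]]]; apply: s_tri.
Qed.

Lemma nonuniversal_nonadj (G : sgraph) (v : G) : ~~ universal v -> exists w, nonadj v w.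
Proof.
move=> uv; have [/existsP//|nex] := boolP [exists w, nonadj v w].
case/negP: uv; rewrite /universal /degree.
have -> : [set w | adj v w] = [set~ v].
  apply/setP => w; rewrite !inE; move: nex; rewrite negb_exists => /forallP/(_ w).
  rewrite negb_and !negbK eq_sym.
  by have [->|_ /=] := eqVneq w v; [rewrite adj_irrefl | move->].
by rewrite cardsC1.
Qed.

Lemma vertex_map (G1 G2 : sgraph) (s : {set G1} -> {set G2}) : line_iso s ->
  (forall v : G1, exists w, nonadj v w) -> (forall v : G2, exists w, nonadj v w) ->
  exists2 h : G1 -> G2, h @: setT = setT &
    forall x y, nonadj x y -> s [set x; y] = [set h x; h y].
Proof.
move=> s_iso iso1 iso2; have [h hP] := whitney s_iso iso1; exists h => //.
apply/setP => x; rewrite inE; have [y /mem_nonedges/(li_onto s_iso)[e en sE]] := iso2 x.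
have [a [b [ab eE]]] := nonedgesP _ en.
have := set21 x y; rewrite -sE eE hP // !inE => /orP[]/eqP->; exact: imset_f.
Qed.

Theorem theorem1p3 (G1 G2 : sgraph) (k1 k2 : nat)
    (no_universal1 : forall v : G1, ~~ universal v)
    (no_universal2 : forall v : G2, ~~ universal v)
    (* k_i <= n_i - 2 without truncated subtraction *)
    (le_k1 : k1 + 2 <= #|G1|) (le_k2 : k2 + 2 <= #|G2|) :
  isomorphic (upper_bell k1 G1) (upper_bell k2 G2) -> isomorphic G1 G2.
Proof.
move=> iso12; have iso21 := isomorphic_sym iso12.
have nu1 v := nonuniversal_nonadj (no_universal1 v).
have nu2 v := nonuniversal_nonadj (no_universal2 v).
have [s s_iso] := line_iso_exists le_k1 le_k2 iso12.
have [r r_iso] := line_iso_exists le_k2 le_k1 iso21.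
have [h h_onto hE] := vertex_map s_iso nu1 nu2.
have [h' h'_onto _] := vertex_map r_iso nu2 nu1.
have le21 : #|G2| <= #|G1| by rewrite -!cardsT -h_onto leq_imset_card.
have le12 : #|G1| <= #|G2| by rewrite -!cardsT -h'_onto leq_imset_card.
have h_inj : injective h.
  move=> x y; have /imset_injP : #|h @: setT| == #|[set: G1]|.
    by rewrite h_onto !cardsT eqn_leq le12 le21.
  by apply; rewrite inE.
exists h; first exact: inj_card_bij.
move=> x y; have [->|xy] := eqVneq x y; first by rewrite !adj_irrefl.
have hxy : h x != h y by rewrite (inj_eq h_inj).
apply: negb_inj; suff : nonadj (h x) (h y) = nonadj x y by rewrite /nonadj xy hxy.
apply/idP/idP => [/mem_nonedges/(li_onto s_iso)[e en]|nxy]; last first.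
  by apply: nonedges_nonadj hxy; rewrite -hE // (li_in s_iso) ?mem_nonedges.
have [a [b [ab ->]]] := nonedgesP _ en; rewrite hE // => hab.
have hanb : h a != h b by rewrite (inj_eq h_inj) nonadj_neq.
by case: (set2_inj hanb hab) => -[/h_inj<- /h_inj<-] //; rewrite nonadj_sym.
Qed.
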